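(* If two virtual strings are homotopic, then their based matrices are homologous.
   Context: Virtual strings. For $m\ge0$, a virtual string (string) $\alpha$ of rank $m$ is an oriented circle $S$ (core circle) with $2m$ distinguished distinct points (the endpoints of $\alpha$) partitioned into $m$ ordered pairs, the arrows; their set is $\mathrm{arr}(\alpha)$. For an arrow $(a,b)$, $a$ is the tail, $b$ the head. A homeomorphism of strings is an orientation-preserving homeomorphism of core circles carrying the set of arrows onto the set of arrows. For distinct $a,b\in S$, $ab$ denotes the arc of $S$ going from $a$ to $b$ in the positive direction. Homotopy. Consider the following moves on a string $\alpha$ with core circle $S$. $(a)_s$: for distinct $a,b\in S$ such that the arc $ab$ contains no endpoints of $\alpha$, add the arrow $(a,b)$. $(b)_s$: choose two arcs on $S$ disjoint from each other and from the endpoints of $\alpha$; let $a,a'$ be the endpoints of the first arc (in arbitrary order) and $b,b'$ those of the second (in arbitrary order); add the arrows $(a,b)$ and $(b',a')$. $(c)_s$: if $\alpha$ has three arrows $(a^+,b),(b^+,c),(c^+,a)$ such that the arcs $aa^+,bb^+,cc^+$ are disjoint from each other and from the other endpoints of $\alpha$, replace them with the arrows $(a,b^+),(b,c^+),(c,a^+)$. Two strings are homotopic if they are related by a finite sequence of homeomorphisms, moves $(a)_s,(b)_s,(c)_s$, and inverse moves. Based matrices. A based matrix is a triple $(G,s,b)$ where $G$ is a finite set, $s\in G$, and $b:G\times G\to\mathbb Z$ satisfies $b(g,h)=-b(h,g)$. An isomorphism of based matrices $(G,s,b)\to(G',s',b')$ is a bijection $G\to G'$ sending $s$ to $s'$ and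 transforming $b$ into $b'$. Elementary extensions of $(G,s,b)$: $M_1$ yields $(G\amalg\{g\},s,\overline b)$ with $\overline b$ skew-symmetric extending $b$ and $\overline b(g,h)=0$ for all $h$; $M_2$ yields $(G\amalg\{g\},s,\tilde b)$ with $\tilde b$ skew-symmetric extending $b$ and $\tilde b(g,h)=\tilde b(s,h)$ for all $h$; $M_3$ yields $(G\amalg\{g_1,g_2\},s,\hat b)$ with $\hat b$ any skew-symmetric map extending $b$ such that $\hat b(g_1,h)+\hat b(g_2,h)=\hat b(s,h)$ for all $h\in G\amalg\{g_1,g_2\}$. Two based matrices are homologous if one is obtained from the other by a finite sequence of elementary extensions $M_1,M_2,M_3$, inverse transformations, and isomorphisms. The surface $\Sigma_\alpha$. Let $\alpha$ be a string with core circle $S$. Identifying the tail with the head of each arrow transforms $S$ into a graph $\Gamma_\alpha$. If $\alpha$ has no arrows, $\Sigma_\alpha=S\times[-1,1]$. Otherwise, $\Gamma_\alpha$ has one 4-valent vertex for each arrow $(a,b)$; a neighborhood of it is embedded in a copy of the unit disc $D^2\subset\mathbb R^2$ (with counterclockwise orientation) so that the vertex goes to the origin, the incoming arcs at $a$, $b$ go to $[-1,0]\times0$, $0\times[-1,0]$, and the outgoing arcs at $a$, $b$ go to $[0,1]\times0$, $0\times[0,1]$, respectively. Each edge of $\Gamma_\alpha$ is thickened to a ribbon connecting the corresponding discs so that the orientations of the discs extend over the ribbon. The result is a compact connected oriented surface $\Sigma_\alpha\supset\Gamma_\alpha$, and the composition $\omega_\alpha:S\to\Gamma_\alpha\hookrightarrow\Sigma_\alpha$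 is a closed curve. The based matrix of a string. Let $B:H_1(\Sigma_\alpha;\mathbb Z)\times H_1(\Sigma_\alpha;\mathbb Z)\to\mathbb Z$ be the homological intersection pairing. Put $[s]=[\omega_\alpha(S)]\in H_1(\Sigma_\alpha;\mathbb Z)$ and, for an arrow $e=(a,b)$, let $[e]\in H_1(\Sigma_\alpha;\mathbb Z)$ be the class of the loop $\omega_\alpha(ab)$. The based matrix of $\alpha$ is $T(\alpha)=(G,s,b)$ with $G=\{s\}\amalg\mathrm{arr}(\alpha)$ and $b(g,h)=B([g],[h])$ for $g,h\in G$. *)

(* Defs.v *)
From HB Require Import structures.
From Stdlib Require Export Relation_Operators.
From mathcomp Require Export all_boot all_order all_algebra finmap.
From mathcomp Require Export mathcomp_extra boolp classical_sets reals.
From mathcomp Require Export topology normedtype.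
From mathcomp Require Import ring.

Set Implicit Arguments.
Unset Strict Implicit.
Unset Printing Implicit Defensive.

Import Order.TTheory GRing.Theory Num.Theory.
Import numFieldNormedType.Exports.
Local Open Scope classical_set_scope.
Local Open Scope ring_scope.

(** * Virtual strings *)

(* The oriented circle R/Z; a point is represented by its angle in [0, 1[,
   and the positive direction is that of increasing angles. *)
Record circle (R : realType) :=
  Circle { angle :> R; angle_itv : 0 <= angle < 1 }.

HB.instance Definition _ (R : realType) := [isSub for @angle R].
HB.instance Definition _ (R : realType) := [Choice of circle R by <:].

Definition frac (R : realType) (x : R) : R := x - (Num.floor x)%:~R.

Lemma frac_itv (R : realType) (x : R) : 0 <= frac x < 1.
Proof.
by rewrite /frac subr_ge0 ltrBlDl -[1]/(1%:~R) -intrD; exact: floor_itv.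
Qed.

(* The universal covering R -> R/Z. *)
Definition circle_cover (R : realType) (x : R) : circle R :=
  Circle (frac_itv x).

(* The closed arc going from a to b in the positive direction (a != b):
   frac (x - a) is the length of the positive path from a to x. *)
Definition arc (R : realType) (a b : circle R) : set (circle R) :=
  [set x : circle R | frac (angle x - angle a) <= frac (angle b - angle a)].

(* f is induced by an increasing homeomorphism of R commuting with x |-> x + 1
   (continuity of the inverse of F is automatic). *)
Definition circle_homeo (R : realType) (f : circle R -> circle R) : Prop :=
  exists F : R -> R,
    [/\ continuous F,
        {homo F : x y / x < y},
        forall x, F (x + 1) = F x + 1 &
        forall x, f (circle_cover x) = circle_cover (F x)].

(* The endpoint of an arrow (a, b) : the tail a for false, the head b for true. *)
Definition endpoint (T : Type) (e : T * T) (is_head : bool) : T :=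
  if is_head then e.2 else e.1.

Record vstring (R : realType) := VString {
  arrows : {fset (circle R * circle R)};
  endpoints_distinct :
    injective (fun p : arrows * bool => endpoint (val p.1) p.2) }.

Section Strings.
Variable R : realType.
Implicit Types (al be : vstring R) (a b c p q : circle R).

Definition arr al : finType := arrows al.

Definition pos al (p : arr al * bool) : circle R := endpoint (val p.1) p.2.

Definition endpoints al : set (circle R) := range (@pos al).

Definition string_homeo al be : Prop :=
  exists f : circle R -> circle R,
    circle_homeo f /\
    arrows be = [fset (f e.1, f e.2) | e in arrows al]%fset.

Definition move_a al be : Prop :=
  exists a b : circle R,
    [/\ a != b,
        arc a b `&` endpoints al = set0 &
        arrows be = ((a, b) |` arrows al)%fset].

Definition move_b al be : Prop :=
  exists p p' q q' : circle R,
    [/\ p != p', q != q',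
        [/\ arc p p' `&` arc q q' = set0,
            arc p p' `&` endpoints al = set0 &
            arc q q' `&` endpoints al = set0] &
        exists a a' b b' : circle R,
          [/\ (a, a') = (p, p') \/ (a, a') = (p', p),
              (b, b') = (q, q') \/ (b, b') = (q', q) &
              arrows be = ([fset (a, b); (b', a')] `|` arrows al)%fset]].

Definition move_c al be : Prop :=
  exists a a' b b' c c' : circle R,
    [/\ [/\ (a', b) \in arrows al, (b', c) \in arrows al &
            (c', a) \in arrows al],
        [/\ arc a a' `&` arc b b' = set0,
            arc b b' `&` arc c c' = set0 &
            arc c c' `&` arc a a' = set0],
        (arc a a' `|` arc b b' `|` arc c c') `&`
          (endpoints al `\` [set x | x \in [:: a; a'; b; b'; c; c']]) = set0 &
        arrows be = ([fset (a, b'); (b, c'); (c, a')] `|`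
                     (arrows al `\` [fset (a', b); (b', c); (c', a)]))%fset].

Inductive string_step al be : Prop :=
| step_homeo of string_homeo al be
| step_a of move_a al be
| step_b of move_b al be
| step_c of move_c al be.

Definition homotopic : vstring R -> vstring R -> Prop :=
  clos_refl_sym_trans (vstring R) string_step.

End Strings.

(** * Based matrices *)

Definition skew (T : Type) (b : T -> T -> int) : Prop :=
  forall g h, b g h = - b h g.

Record based_matrix := BasedMatrix {
  bm_set :> finType;
  bm_s : bm_set;
  bm_b : bm_set -> bm_set -> int;
  bm_skew : skew bm_b }.

Definition bm_iso (M N : based_matrix) : Prop :=
  exists f : M -> N,
    [/\ bijective f, f (bm_s M) = bm_s N &
        forall g h, bm_b (f g) (f h) = bm_b g h].

Definition extends (M : based_matrix) (K : Type)
    (c : M + K -> M + K -> int) : Prop :=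
  forall g h : M, c (inl g) (inl h) = bm_b g h.

(* The new elements of G are inr tt (for M1 and M2), inr false and inr true
   (for M3). *)
Inductive elementary_extension (M : based_matrix) : based_matrix -> Prop :=
| ext_M1 (c : M + unit -> M + unit -> int) (c_skew : skew c) of
    extends c &
    (forall h, c (inr tt) h = 0) :
    elementary_extension M
      (@BasedMatrix (M + unit)%type (inl (bm_s M)) c c_skew)
| ext_M2 (c : M + unit -> M + unit -> int) (c_skew : skew c) of
    extends c &
    (forall h, c (inr tt) h = c (inl (bm_s M)) h) :
    elementary_extension M
      (@BasedMatrix (M + unit)%type (inl (bm_s M)) c c_skew)
| ext_M3 (c : M + bool -> M + bool -> int) (c_skew : skew c) of
    extends c &
    (forall h, c (inr false) h + c (inr true) h = c (inl (bm_s M)) h) :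
    elementary_extension M
      (@BasedMatrix (M + bool)%type (inl (bm_s M)) c c_skew).

Inductive matrix_step (M N : based_matrix) : Prop :=
| step_iso of bm_iso M N
| step_extension of elementary_extension M N.

Definition homologous : based_matrix -> based_matrix -> Prop :=
  clos_refl_sym_trans based_matrix matrix_step.

(** * Simplicial homology and intersection pairing of oriented surfaces *)

(* A finite oriented 2-dimensional Delta-complex.  A triangle t has ordered
   vertices v0, v1, v2 and edges e01 t = v0v1, e12 t = v1v2, e02 t = v0v2;
   rev t means that the orientation v0, v1, v2 of t is opposite to that of the
   surface. *)
Record dcomplex := DComplex {
  dvert : finType;
  dedge : finType;
  dface : finType;
  src : dedge -> dvert;
  tgt : dedge -> dvert;
  e01 : dface -> dedge;
  e12 : dface -> dedge;
  e02 : dface -> dedge;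
  rev : dface -> bool;
  simplicial : forall t,
    [/\ src (e01 t) = src (e02 t), tgt (e01 t) = src (e12 t) &
        tgt (e12 t) = tgt (e02 t)] }.

Definition chain (I : finType) := {ffun I -> int}.

Section Homology.
Variable X : dcomplex.
Implicit Types (x y z phi psi : chain (dedge X)) (k : chain (dface X)).

Definition edge_chain (e : dedge X) : chain (dedge X) :=
  [ffun f => (e == f)%:Z].

Definition bd1 x : chain (dvert X) :=
  [ffun v => \sum_e x e * ((tgt e == v)%:Z - (src e == v)%:Z)].

Definition bd2 k : chain (dedge X) :=
  [ffun e => \sum_t
     k t * ((e01 t == e)%:Z + (e12 t == e)%:Z - (e02 t == e)%:Z)].

Definition cycle1 x : Prop := bd1 x = 0.

(* x and y represent the same class in H_1(X; Z). *)
Definition same_class x y : Prop := exists k, x - y = bd2 k.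

Definition fundamental_chain : chain (dface X) := [ffun t => (-1) ^+ rev t].

Definition boundary_edge (e : dedge X) : bool :=
  #|[set t | e01 t == e]%SET| + #|[set t | e12 t == e]%SET| +
  #|[set t | e02 t == e]%SET| == 1%N.

(* The triangles carry compatible orientations. *)
Definition coherent : Prop :=
  forall e, ~~ boundary_edge e -> bd2 fundamental_chain e = 0.

(* Simplicial 1-cocycles of the pair (X, boundary of X). *)
Definition rel_cocycle phi : Prop :=
  (forall t, phi (e02 t) = phi (e01 t) + phi (e12 t)) /\
  (forall e, boundary_edge e -> phi e = 0).

(* [X] cap phi, with phi evaluated on the front faces. *)
Definition cap phi : chain (dedge X) :=
  [ffun e => \sum_t fundamental_chain t * phi (e01 t) * (e12 t == e)%:Z].

(* < phi cup psi, [X] > *)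
Definition cup_eval phi psi : int :=
  \sum_t fundamental_chain t * phi (e01 t) * psi (e12 t).

Definition dual_to phi x : Prop := rel_cocycle phi /\ same_class (cap phi) x.

Definition intersection_values x y : set int :=
  [set n | exists phi psi,
     [/\ dual_to phi x, dual_to psi y & n = cup_eval phi psi]].

(* The homological intersection pairing, evaluated on the classes of the
   1-cycles x and y: < phi cup psi, [X] >, where phi and psi represent the
   Poincare-Lefschetz duals of x and y in H^1(X, boundary of X; Z).  With the
   present conventions it is 1 for the pair formed by the first and the second
   coordinate circles of the torus R^2/Z^2.  When X is coherent the value does
   not depend on phi and psi (intersection_values_unique below). *)
Definition intersection x y : int := xget 0 (intersection_values x y).

Definition evalc psi x : int := \sum_e psi e * x e.

Lemma cup_evalE phi psi : cup_eval phi psi = evalc psi (cap phi).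
Proof.
rewrite /cup_eval /evalc.
under [RHS]eq_bigr => e _ do rewrite ffunE mulr_sumr.
rewrite exchange_big /=; apply: eq_bigr => t _.
rewrite (bigD1 (e12 t)) //= eqxx mulr1 [X in _ = _ + X]big1 ?addr0; first last.
  by move=> e /negPf ne; rewrite eq_sym ne mulr0 mulr0.
by rewrite mulrC.
Qed.

Lemma evalc_bd2 psi k :
  evalc psi (bd2 k) =
  \sum_t k t * (psi (e01 t) + psi (e12 t) - psi (e02 t)).
Proof.
rewrite /evalc.
under eq_bigr => e _ do rewrite ffunE mulr_sumr.
rewrite exchange_big /=; apply: eq_bigr => t _.
under eq_bigr => e _ do rewrite mulrCA.
rewrite -mulr_sumr; congr (_ * _).
have pick f : \sum_e psi e * (f == e)%:Z = psi f.
  rewrite (bigD1 f) //= eqxx mulr1 big1 ?addr0 // => e /negPf ne.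
  by rewrite eq_sym ne mulr0.
under eq_bigr => e _ do rewrite mulrBr mulrDr.
by rewrite sumrB big_split /= !pick.
Qed.

Lemma bd1_bd2 k : cycle1 (bd2 k).
Proof.
apply/ffunP => v; rewrite !ffunE.
pose c e : int := (tgt e == v)%:Z - (src e == v)%:Z.
under eq_bigr => e _ do rewrite mulrC.
rewrite (eq_bigr (fun e => [ffun e => c e] e * bd2 k e)); last first.
  by move=> e _; rewrite !ffunE.
rewrite -/(evalc _ _) evalc_bd2 big1 // => t _; rewrite !ffunE /c.
by have [-> -> ->] := simplicial t; ring.
Qed.

Lemma evalc_same_class psi x y :
  rel_cocycle psi -> same_class x y -> evalc psi x = evalc psi y.
Proof.
move=> [cpsi _] [k xyk]; apply/eqP; rewrite -subr_eq0; apply/eqP.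
have -> : evalc psi x - evalc psi y = evalc psi (bd2 k).
  rewrite -xyk /evalc -sumrB; apply: eq_bigr => e _.
  by rewrite !ffunE mulrBr.
rewrite evalc_bd2 big1 // => t _.
by rewrite cpsi subrr mulr0.
Qed.

Lemma cup_evalC phi psi :
  coherent -> rel_cocycle phi -> rel_cocycle psi ->
  cup_eval phi psi = - cup_eval psi phi.
Proof.
move=> coX [cphi bphi] [cpsi bpsi].
apply/eqP; rewrite -addr_eq0; apply/eqP.
pose prod : chain (dedge X) := [ffun e => phi e * psi e].
have H : evalc prod (bd2 fundamental_chain) = 0.
  rewrite /evalc big1 // => e _; rewrite ffunE.
  have [be|nbe] := boolP (boundary_edge e); first by rewrite bphi // !mul0r.
  by rewrite coX // mulr0.
rewrite -[RHS]oppr0 -H evalc_bd2 -sumrN -big_split /=.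
apply: eq_bigr => t _; rewrite !ffunE cphi cpsi.
ring.
Qed.

Lemma intersection_values_skew x y n :
  coherent -> intersection_values x y n -> intersection_values y x (- n).
Proof.
move=> coX [phi [psi [[cphi xphi] [cpsi ypsi] ->]]]; exists psi, phi.
by split; [split | split | rewrite (cup_evalC coX) // opprK].
Qed.

Lemma intersection_values_unique x y m n :
  coherent -> intersection_values x y m -> intersection_values x y n -> m = n.
Proof.
move=> coX [phi [psi [[cphi xphi] [cpsi ypsi] ->]]].
move=> [phi' [psi' [[cphi' xphi'] [cpsi' ypsi'] ->]]].
have -> : cup_eval phi psi = cup_eval phi' psi.
  by rewrite !cup_evalE (evalc_same_class cpsi xphi) (evalc_same_class cpsi xphi').
rewrite (cup_evalC coX cphi' cpsi) (cup_evalC coX cphi' cpsi'); congr (- _).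
by rewrite !cup_evalE (evalc_same_class cphi' ypsi) (evalc_same_class cphi' ypsi').
Qed.

Lemma intersectionC x y :
  coherent -> intersection x y = - intersection y x.
Proof.
move=> coX; rewrite {1}/intersection.
case: xgetP => [n _ vn|noxy].
  rewrite /intersection.
  have vn' := intersection_values_skew coX vn.
  rewrite (xget_unique _ vn') ?opprK // => m vm.
  exact: intersection_values_unique coX vm vn'.
rewrite /intersection; case: xgetP => [n _ vn|_]; last by rewrite oppr0.
by case: (noxy (- n)); exact: intersection_values_skew.
Qed.

End Homology.

(** * The surface of a string *)

Section Surface.
Variables (R : realType) (al : vstring R).

(* The circle is cut at the endpoints of al or, when al has no arrows, at one
   auxiliary point; 'I_(b) has one element if b = true and none otherwise. *)
Definition aux : finType := 'I_(#|` arrows al| == 0%N).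
Definition cut : finType := ((arr al * bool) + aux)%type.

(* The endpoints, in the order of increasing angles. *)
Definition endpoint_seq : seq (arr al * bool) :=
  sort (fun p q => angle (pos p) <= angle (pos q)) (enum {: arr al * bool}).

(* The next cutting point in the positive direction. *)
Definition next_cut (p : cut) : cut :=
  match p with
  | inl q => inl (next endpoint_seq q)
  | inr i => inr i
  end.

(* The graph Gamma has vertex set gvert; its edges are indexed by cut, p being
   the edge that comes from the arc of the circle going from p to next_cut p. *)
Definition gvert : finType := (arr al + aux)%type.
Definition vertex_at (p : cut) : gvert :=
  match p with
  | inl q => inl q.1
  | inr i => inr i
  end.

(* The surface is a thickening of Gamma.  Around the vertex of an arrow, the
   disc with the four half-edges removed has four quadrants; the quadrant
   (is_east, is_north) consists of the points (x, y) of the disc with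
   x > 0 iff is_east and y > 0 iff is_north.  Each quadrant contains a corner,
   i.e. a chosen point on the boundary of the surface.  The auxiliary vertex
   has two corners, to the left (true) and to the right (false) of the curve. *)
Definition corner : finType := ((arr al * (bool * bool)) + (aux * bool))%type.

Definition corner_vertex (c : corner) : gvert :=
  match c with
  | inl c => inl c.1
  | inr c => inr c.1
  end.

(* The corner adjacent to the outgoing (out = true) or incoming (out = false)
   half-edge at p, on its left or right side.  At the tail the curve goes from
   west to east, at the head it goes from south to north. *)
Definition corner_at (p : cut) (out left : bool) : corner :=
  match p with
  | inl (e, false) => inl (e, (out, left))
  | inl (e, true) => inl (e, (~~ left, out))
  | inr i => inr (i, left)
  end.

(* Cutting the surface along Gamma and along segments (spokes) joining each
   vertex to its corners yields, for each edge p of Gamma, two half-ribbons: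
   the rectangles on the left (l = true) and on the right (l = false) of p.

       corner_at p true l ---- rim (p, l) ---> corner_at (next_cut p) false l
              ^                                           ^
            spoke                                       spoke
              |                                           |
         vertex_at p -------- core p --------> vertex_at (next_cut p)

   Each rectangle is divided into two triangles by its diagonal starting at
   vertex_at p. *)
Inductive sigma_edge_spec : Type :=
| Core of cut
| Spoke of corner
| Rim of cut * bool
| Diag of cut * bool.

Definition sigma_edge_code (e : sigma_edge_spec) :=
  match e with
  | Core p => inl (inl p)
  | Spoke c => inl (inr c)
  | Rim r => inr (inl r)
  | Diag r => inr (inr r)
  end.

Definition sigma_edge_decode
    (e : (cut + corner) + ((cut * bool) + (cut * bool))) :=
  match e with
  | inl (inl p) => Core p
  | inl (inr c) => Spoke c
  | inr (inl r) => Rim r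
  | inr (inr r) => Diag r
  end.

Lemma sigma_edge_codeK : cancel sigma_edge_code sigma_edge_decode.
Proof. by case. Qed.

HB.instance Definition _ := Finite.copy sigma_edge_spec
  (can_type sigma_edge_codeK).

Definition sigma_src (e : sigma_edge_spec) : gvert + corner :=
  match e with
  | Core p => inl (vertex_at p)
  | Spoke c => inl (corner_vertex c)
  | Rim (p, l) => inr (corner_at p true l)
  | Diag (p, l) => inl (vertex_at p)
  end.

Definition sigma_tgt (e : sigma_edge_spec) : gvert + corner :=
  match e with
  | Core p => inl (vertex_at (next_cut p))
  | Spoke c => inr c
  | Rim (p, l) => inr (corner_at (next_cut p) false l)
  | Diag (p, l) => inr (corner_at (next_cut p) false l)
  end.

(* Triangles (p, l, is_lower): the lower triangle is the one that contains
   core p, the upper one contains rim (p, l). *)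
Definition sigma_face : finType := (cut * bool * bool)%type.

Definition sigma_e01 (t : sigma_face) : sigma_edge_spec :=
  let: (p, l, is_lower) := t in
  if is_lower then Core p else Spoke (corner_at p true l).

Definition sigma_e12 (t : sigma_face) : sigma_edge_spec :=
  let: (p, l, is_lower) := t in
  if is_lower then Spoke (corner_at (next_cut p) false l) else Rim (p, l).

Definition sigma_e02 (t : sigma_face) : sigma_edge_spec :=
  let: (p, l, is_lower) := t in Diag (p, l).

(* The lower triangle on the left and the upper triangle on the right of an
   edge are positively oriented. *)
Definition sigma_rev (t : sigma_face) : bool :=
  let: (p, l, is_lower) := t in is_lower (+) l.

Lemma corner_vertex_at (p : cut) (out left : bool) :
  corner_vertex (corner_at p out left) = vertex_at p.
Proof. by case: p => [[e []]|i]. Qed.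

Lemma sigma_simplicial (t : sigma_face) :
  [/\ sigma_src (sigma_e01 t) = sigma_src (sigma_e02 t),
      sigma_tgt (sigma_e01 t) = sigma_src (sigma_e12 t) &
      sigma_tgt (sigma_e12 t) = sigma_tgt (sigma_e02 t)].
Proof. by case: t => [[p l] []] /=; rewrite ?corner_vertex_at. Qed.

Definition sigma : dcomplex :=
  @DComplex (gvert + corner)%type sigma_edge_spec sigma_face
    sigma_src sigma_tgt sigma_e01 sigma_e12 sigma_e02 sigma_rev
    sigma_simplicial.

Lemma next_cut_bij : bijective next_cut.
Proof.
have un : uniq endpoint_seq by rewrite sort_uniq enum_uniq.
exists (fun p => match p with
        | inl q => inl (prev endpoint_seq q) | inr i => inr i end).
  by case=> //= q; rewrite prev_next.
by case=> //= q; rewrite next_prev.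
Qed.

Lemma big_sigma_face (F : sigma_face -> int) :
  \sum_t F t = \sum_p (F (p, true, true) + F (p, true, false) +
                     (F (p, false, true) + F (p, false, false))).
Proof.
transitivity (\sum_(q : cut * bool) \sum_(b : bool) F (q, b)).
  by rewrite pair_bigA; apply: eq_bigr => -[].
transitivity (\sum_(p : cut) \sum_(l : bool) \sum_(b : bool) F (p, l, b)).
  by rewrite (pair_bigA _ (fun p l => \sum_(b : bool) F (p, l, b))); apply: eq_bigr => -[].
by apply: eq_bigr => p _; rewrite !big_bool.
Qed.

Lemma corner_sum (d : corner -> int) :
  \sum_(p : cut)
    (d (corner_at p true false) - d (corner_at p true true) +
     (d (corner_at (next_cut p) false true) -
      d (corner_at (next_cut p) false false))) = 0.
Proof.
pose o q := d (corner_at q true false) - d (corner_at q true true).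
pose i q := d (corner_at q false true) - d (corner_at q false false).
transitivity (\sum_(q : cut) (o q + i q)).
  rewrite [LHS]big_split [RHS]big_split /=; congr (_ + _).
  by rewrite [RHS](reindex next_cut) //; exact/onW_bij/next_cut_bij.
rewrite big_sumType /= [X in _ + X]big1 ?addr0; last first.
  by move=> j _; rewrite /o /i /= addrA subrK subrr.
transitivity (\sum_e \sum_(b : bool) (o (inl (e, b)) + i (inl (e, b)))).
  by rewrite pair_bigA; apply: eq_bigr => -[].
rewrite big1 // => e _; rewrite big_bool /o /i /=.
move: (d (inl (e, (true, true)))) (d (inl (e, (true, false))))
  (d (inl (e, (false, true)))) (d (inl (e, (false, false)))) => x y z t.
ring.
Qed.

Lemma sigma_coherent : coherent sigma.
Proof.
move=> [p|c|r|r].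
- move=> _; rewrite ffunE big_sigma_face big1 // => q _.
  by rewrite !ffunE /= subrr; ring.
- move=> _; rewrite ffunE big_sigma_face.
  rewrite -[RHS](corner_sum (fun x => (Spoke x == Spoke c)%:Z)).
  by apply: eq_bigr => q _; rewrite !ffunE /=; ring.
- case/negP; rewrite /boundary_edge.
  have -> : [set t | e01 t == (Rim r : dedge sigma)]%SET = finset.set0.
    by apply/setP => -[[q l] []]; rewrite !inE.
  have -> : [set t | e12 t == (Rim r : dedge sigma)]%SET =
            [set (r, false)]%SET :> {set sigma_face}.
    by apply/setP => -[[q l] []]; rewrite !inE [RHS]xpair_eqE ?andbF ?andbT.
  have -> : [set t | e02 t == (Rim r : dedge sigma)]%SET = finset.set0.
    by apply/setP => -[[q l] []]; rewrite !inE.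
  by rewrite !cards0 cards1.
- move=> _; rewrite ffunE big_sigma_face big1 // => q _.
  by rewrite !ffunE /=; ring.
Qed.

(** * The based matrix of a string *)

(* The 1-cycle of the curve omega : S -> Gamma. *)
Definition curve_chain : chain (dedge sigma) :=
  \sum_(p : cut) edge_chain (Core p : dedge sigma).

(* The 1-cycle of the loop omega(ab), for an arrow e = (a, b): the arc ab
   consists of the arcs starting at the endpoints in ab other than b. *)
Definition loop_chain (e : arr al) : chain (dedge sigma) :=
  \sum_(p : arr al * bool |
        `[< arc (val e).1 (val e).2 (pos p) >] && (pos p != (val e).2))
     edge_chain (Core (inl p) : dedge sigma).

Definition class_chain (g : option (arr al)) : chain (dedge sigma) :=
  if g is Some e then loop_chain e else curve_chain.

Definition string_b (g h : option (arr al)) : int :=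
  intersection (class_chain g) (class_chain h).

Lemma string_b_skew : skew string_b.
Proof. by move=> g h; exact: (intersectionC _ _ sigma_coherent). Qed.

Definition string_matrix : based_matrix :=
  @BasedMatrix (option (arr al)) None string_b string_b_skew.

End Surface.

(* Main.v *)
Require Import Defs.
From mathcomp Require Import ring lra zify.

Set Implicit Arguments.
Unset Strict Implicit.
Unset Printing Implicit Defensive.

Import Order.TTheory GRing.Theory Num.Theory.
Import numFieldNormedType.Exports.
Local Open Scope ring_scope.

(** The intersection number of two 1-cycles carried by the core graph of the
    surface can be computed at the crossings: [intersection_core] gives it as
    a sum over the arrows of al, in which an arrow contributes a bilinear
    expression in the multiplicities of the two cycles on the four half-edges
    at its vertex.  The reason is that the Poincare-Lefschetz dual of such a
    cycle is given by a height function on the corners, which drops by the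
    multiplicity of an edge when that edge is crossed from right to left.

    For the cycles that occur in a based matrix, the multiplicities are
    indicator functions of arcs of the circle, so that [string_bE] expresses
    the matrix by the cyclic order of the endpoints alone:

      b (g, h) = sum over the arrows (x, y) of
                   g_out x * h_out y - g_in y * h_in x

    where, for g = (a, b), g_out is the indicator function of [a, b[ and g_in
    that of ]a, b], and both are 1 for g = s.  It remains to follow this
    formula through the moves.

    - A homeomorphism preserves the cyclic order, hence the matrix.
    - The move (a) adds an arrow whose loop pairs to zero with everything,
      which is an extension M1 ([move_a_homologous]).
    - The move (b) adds two arrows whose loops add up to the whole curve, up
      to corrections along two short arcs that cancel in the pairing; this is
      an extension M3 ([opposite_arrows_pairing], [move_b_homologous]).
    - The move (c) slides three crossings past one another.  The multiplicities
      of corresponding cycles change only on the three short arcs, the sides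
      of the triangle formed by the crossings.  Kirchhoff's law at the three
      crossings determines them there up to a multiple of the boundary of the
      triangle, which pairs to zero with everything ([triangle_identity]); so
      the matrices are isomorphic ([move_c_homologous]). *)

(** * Arcs of the circle and their indicator functions *)

Lemma setI0_notin (T : Type) (A B : set T) (t : T) :
  (A `&` B = set0)%classic -> A t -> ~ B t.
Proof. by move=> AB At Bt; have : (A `&` B)%classic t by []; rewrite AB. Qed.

Section Arcs.
Variable R : realType.
Implicit Types (a b c d p q x y : circle R) (n : circle R * circle R).

(** With values in int, so that statements about the cyclic order become linear
    identities. *)
Definition before x y : int := (angle x <= angle y)%R%:Z.

Lemma before_refl x : before x x = 1.
Proof. by rewrite /before lexx. Qed.

Lemma before_neq x y : x != y -> before y x = 1 - before x y.
Proof.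
move=> xy; have {}xy : angle x != angle y by rewrite -(inj_eq val_inj) in xy.
by rewrite /before; case: ltgtP xy.
Qed.

(** The classes whose pairings form the based matrix: the loop of an arrow, or
    the whole curve for None. *)
Definition arrow_class : Type := option (circle R * circle R).
Implicit Types g h : arrow_class.

(** The multiplicities of the cycle of g on the arcs of the circle that leave and
    enter x: for g = (a, b), the indicator functions of [a, b[ and ]a, b].  They
    are written as differences of step functions, the constant accounting for
    arcs that run into the angle 0, because their dependence on each of a and b
    is then visible. *)
Definition flow_out g x : int :=
  if g is Some (a, b) then before a x - before b x + 1 - before a b else 1.

Definition flow_in g x : int :=
  if g is Some (a, b) then before x b - before x a + 1 - before a b else 1.

Arguments flow_out : simpl never.
Arguments flow_in : simpl never.

Lemma frac_sub x a :
  frac (angle x - angle a) = angle x - angle a + (angle x < angle a)%R%:R.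
Proof.
have /andP[x0 x1] := angle_itv x; have /andP[a0 a1] := angle_itv a.
rewrite /frac (@floor_def _ _ (- (angle x < angle a)%R%:Z)) ?rmorphN ?opprK //.
by case: ltP => xa /=; apply/andP; split; lra.
Qed.

Lemma flow_out_frac a b x :
  flow_out (Some (a, b)) x =
  (frac (angle x - angle a) < frac (angle b - angle a))%R%:Z.
Proof.
have /andP[x0 x1] := angle_itv x; have /andP[a0 a1] := angle_itv a.
have /andP[b0 b1] := angle_itv b.
rewrite !frac_sub /flow_out /before.
case: (leP (angle a) (angle x)) => ax; case: (leP (angle b) (angle x)) => bx;
  case: (leP (angle a) (angle b)) => ab /=;
  by case: ltP => //= ?; exfalso; lra.
Qed.

Lemma frac_sub_inj a : injective (fun x : circle R => frac (angle x - angle a)).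
Proof.
move=> x b /=; rewrite !frac_sub => eq_frac; apply/val_inj => /=.
have /andP[x0 x1] := angle_itv x; have /andP[b0 b1] := angle_itv b.
by move: eq_frac; case: ltP => ?; case: ltP => ? /=; lra.
Qed.

Lemma flow_out_arc a b x :
  flow_out (Some (a, b)) x = (`[< arc a b x >] && (x != b))%:Z.
Proof.
rewrite flow_out_frac /arc /= asboolb lt_neqAle andbC.
congr (Posz (nat_of_bool (_ && ~~ _))).
by apply/eqP/eqP => [/frac_sub_inj|->].
Qed.

Lemma flow_in_out a b x :
  flow_in (Some (a, b)) x = flow_out (Some (a, b)) x - (x == a)%:Z + (x == b)%:Z.
Proof.
have eqE c : (x == c)%:Z = before x c + before c x - 1.
  by have [->|/before_neq ->] := eqVneq x c; rewrite ?before_refl /=; ring.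
by rewrite !eqE /flow_in /flow_out; ring.
Qed.

(** Between p and p', the comparison with c changes only if the arc runs into the
    angle 0, and then by an amount independent of c; this is what makes a flow
    constant along an arc that contains neither end of its arrow. *)
Lemma not_arc_before p p' c : p != p' -> ~ arc p p' c ->
  [/\ c != p, c != p' & before c p = before c p' + 1 - before p p'].
Proof.
have /andP[x0 x1] := angle_itv p; have /andP[a0 a1] := angle_itv p'.
have /andP[b0 b1] := angle_itv c.
rewrite /arc /= => pp' Na; split.
- apply: contra_notN Na => /eqP ->; rewrite [leLHS]frac_sub subrr ltxx addr0.
  by have /andP[] := frac_itv (angle p' - angle p).
- by apply: contra_notN Na => /eqP ->.
have {}pp' : angle p != angle p' by rewrite -(inj_eq val_inj) in pp'.
move: Na pp'; rewrite !frac_sub /before.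
case: (ltgtP (angle p) (angle p')) => // h1;
 case: (leP (angle c) (angle p)) => h2; case: (leP (angle c) (angle p')) => h3 //=;
 try lra; move=> Na _; exfalso; apply: Na; case: ltP => /=; lra.
Qed.

(** The point c does not lie strictly between p and q; when p = q, that open
    arc consists of all other points. *)
Definition gap p q c : Prop :=
  before c p = 1 - before q c + before q p.

Lemma flow_gap p q a b : gap p q a -> gap p q b ->
  flow_out (Some (a, b)) p = flow_in (Some (a, b)) q.
Proof. by rewrite /gap /flow_in /flow_out => -> ->; ring. Qed.

(** The contribution of the crossing n to the intersection number of g and h:
    transversal branches leaving the crossing count with one sign, those
    entering it with the other. *)
Definition local_pairing n g h : int :=
  flow_out g n.1 * flow_out h n.2 - flow_in g n.2 * flow_in h n.1.

Definition pairing (A : seq (circle R * circle R)) g h : int :=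
  \sum_(n <- A) local_pairing n g h.

(** Kirchhoff's law at the crossing n. *)
Definition balanced n h : Prop :=
  flow_out h n.1 + flow_out h n.2 = flow_in h n.1 + flow_in h n.2.

Lemma flow_off a b x : x != a -> x != b ->
  flow_in (Some (a, b)) x = flow_out (Some (a, b)) x.
Proof. by move=> /negPf xa /negPf xb; rewrite flow_in_out xa xb subr0 addr0. Qed.

Lemma arrow_balanced a b : balanced (a, b) (Some (a, b)).
Proof. by rewrite /balanced /flow_in /flow_out /= !before_refl; ring. Qed.

Lemma not_arc_gap p p' c : p != p' -> ~ arc p p' c -> gap p p' c.
Proof.
move=> pp' /(not_arc_before pp')[_ cp' cE].
by rewrite /gap cE (before_neq pp') (before_neq cp'); ring.
Qed.

Lemma gap_src p p' : gap p p' p.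
Proof. by rewrite /gap before_refl; ring. Qed.

Lemma gap_tgt p p' : gap p p' p'.
Proof. by rewrite /gap before_refl; ring. Qed.

Lemma arc_src a b : arc a b a.
Proof.
rewrite /arc /= [leLHS]frac_sub subrr ltxx addr0.
by have /andP[] := frac_itv (angle b - angle a).
Qed.

Lemma arc_tgt a b : arc a b b.
Proof. exact: lexx. Qed.

Lemma disjoint_arcs_neq p p' q q' :
  (arc p p' `&` arc q q' = set0)%classic -> p != q /\ p' != q'.
Proof.
move=> dis; split; apply/eqP => pq.
  by apply: (setI0_notin dis (arc_src p p')); rewrite pq; exact: arc_src.
by apply: (setI0_notin dis (arc_tgt p p')); rewrite pq; exact: arc_tgt.
Qed.

Lemma disjoint_arcs_gap p p' q q' d : p != p' -> q != q' ->
  (arc p p' `&` arc q q' = set0)%classic -> d = p \/ d = p' ->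
  gap p p' d /\ gap q q' d.
Proof.
move=> pp' qq' dis dE; split.
  by case: dE => ->; [exact: gap_src | exact: gap_tgt].
apply/not_arc_gap/(setI0_notin dis) => //.
by case: dE => ->; [exact: arc_src | exact: arc_tgt].
Qed.

(** Two disjoint arcs can be placed in the circle in several ways relative to the
    angle 0; three of the comparisons of their ends determine all the others,
    linearly. *)
Lemma disjoint_arcs_before p p' q q' : p != p' -> q != q' ->
  (arc p p' `&` arc q q' = set0)%classic ->
  let u := before p p' in let v := before q q' in let w := before p q in
  [/\ before p' p = 1 - u, before q' q = 1 - v, before q p = 1 - w, before q p' = u - w &
  [/\ before p' q = 1 - u + w, before p q' = w - 1 + v, before q' p = 2 - w - v,
      before q' p' = 1 + u - w - v & before p' q' = w + v - u]].
Proof.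
move=> pp' qq' dis u v w.
have disC : (arc q q' `&` arc p p' = set0)%classic by rewrite setIC.
have [qp qp' E1] := not_arc_before pp' (setI0_notin disC (arc_src q q')).
have [q'p q'p' E2] := not_arc_before pp' (setI0_notin disC (arc_tgt q q')).
have [_ pq' E3] := not_arc_before qq' (setI0_notin dis (arc_src p p')).
move: (before_neq pp') (before_neq qq') (before_neq qp) (before_neq qp').
move: (before_neq q'p) (before_neq q'p').
rewrite -/u -/v -/w in E1 E2 E3 *.
by move=> *; split; [lra..|split; lra].
Qed.

End Arcs.
Arguments flow_out : simpl never.
Arguments flow_in : simpl never.

(** * Intersection numbers of cycles on the core graph *)

Section Core.
Variables (R : realType) (al : vstring R).
Local Notation edge := (dedge (sigma al)).

(** The multiplicity of a cycle on an edge of the graph is recorded both at the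
    cutting point where the edge starts (cyc_out) and at the one where it ends
    (cyc_in), so that the predecessor of a cutting point is never mentioned. *)
Record graph_cycle := GraphCycle {
  cyc_out : cut al -> int;
  cyc_in : cut al -> int;
  cyc_next : forall p, cyc_in (next_cut p) = cyc_out p;
  cyc_balance : forall e : arr al,
    cyc_out (inl (e, false)) + cyc_out (inl (e, true)) =
    cyc_in (inl (e, false)) + cyc_in (inl (e, true)) }.
Implicit Types x y : graph_cycle.

Definition core_chain x : chain edge :=
  [ffun e : edge => (if e is Core p then cyc_out x p else 0) : int].

(** The values of the dual cocycle on the spokes, normalized to be 0 at the
    north-west corner of each crossing and on the left of an auxiliary point.
    The prescribed jumps around a crossing add up to 0 by the balance of the
    cycle. *)
Definition corner_height x (c : corner al) : int :=
  match c with
  | inl (e, (east, north)) =>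
      (if east then cyc_out x (inl (e, true)) else 0) +
      (if north then 0
       else if east then cyc_out x (inl (e, false)) else cyc_in x (inl (e, false)))
  | inr (i, l) => if l then 0 else cyc_out x (inr i)
  end.

Lemma corner_height_jump x p o :
  corner_height x (corner_at p o false) - corner_height x (corner_at p o true) =
  if o then cyc_out x p else cyc_in x p.
Proof.
case: p => [[e []]|i] /=; last first.
- by case: o; rewrite ?subr0 // -(cyc_next x (inr i)).
- by case: o => /=; ring.
case: o => /=; first by ring.
by rewrite add0r [X in X - _]addrC cyc_balance; ring.
Qed.

(** By the cocycle condition and the vanishing on the rims, the values on the
    spokes force the values on all other edges. *)
Definition dual_cochain x : chain edge :=
  [ffun e : edge => match e return int with
   | Core p => corner_height x (corner_at p true true) -
               corner_height x (corner_at (next_cut p) false true)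
   | Spoke c => corner_height x c
   | Rim _ => 0
   | Diag (p, l) => corner_height x (corner_at p true l)
   end].

(** The height changes by the same amount along both sides of an edge, since its
    jump across the edge is the same at both ends. *)
Lemma core_jump x p l :
  corner_height x (corner_at p true true) -
  corner_height x (corner_at (next_cut p) false true) =
  corner_height x (corner_at p true l) -
  corner_height x (corner_at (next_cut p) false l).
Proof.
case: l => //.
have := corner_height_jump x p true.
have := corner_height_jump x (next_cut p) false.
by rewrite cyc_next => in_jump out_jump; lra.
Qed.

Lemma two_faces_interior (e : edge) (t u : dface (sigma al)) :
  [\/ [/\ e01 t = e, e01 u = e & t != u], [/\ e12 t = e, e12 u = e & t != u],
      [/\ e02 t = e, e02 u = e & t != u] | (e01 t = e /\ e12 u = e)] ->
  ~~ boundary_edge e.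
Proof.
have gt1 (f : dface (sigma al) -> edge) : f t = e -> f u = e -> t != u ->
    (1 < #|[set v | f v == e]%SET|)%N.
  by move=> ft fu tu; apply/card_gt1P; exists t, u; rewrite !inE ft fu eqxx.
have gt0 (f : dface (sigma al) -> edge) v : f v = e ->
    (0 < #|[set v | f v == e]%SET|)%N.
  by move=> fv; apply/card_gt0P; exists v; rewrite inE fv.
rewrite /boundary_edge; case=> [[/gt1 h /h{h}h /h]|[/gt1 h /h{h}h /h]|
  [/gt1 h /h{h}h /h]|[/gt0 + /gt0]]; lia.
Qed.

(** Every spoke lies on two faces because a corner lies between two consecutive
    half-edges at its vertex. *)
Lemma boundary_edge_rim (e : edge) :
  boundary_edge e -> if e is Rim _ then True else False.
Proof.
have next_inv (q : cut al) : exists p, next_cut p = q.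
  by have [f _ fK] := next_cut_bij al; exists (f q).
apply: contraPP; case: e => [p|c|r|[p l]] // _; apply/negP.
- apply: (@two_faces_interior _ (p, true, true) (p, false, true)).
  by apply: Or41; split=> //; apply/eqP=> -[].
- case: c => [[e [[] []]]|[i l]].
  + apply: (@two_faces_interior _ (inl (e, false), true, false)
                                  (inl (e, true), false, false)).
    by apply: Or41; split=> //; apply/eqP=> -[].
  + have [p pe] := next_inv (inl (e, true)).
    apply: (@two_faces_interior _ (inl (e, false), false, false) (p, false, true)).
    by apply: Or44; rewrite /= pe.
  + have [p pe] := next_inv (inl (e, false)).
    apply: (@two_faces_interior _ (inl (e, true), true, false) (p, true, true)).
    by apply: Or44; rewrite /= pe.
  + have [p pe] := next_inv (inl (e, false)).
    have [q qe] := next_inv (inl (e, true)).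
    apply: (@two_faces_interior _ (p, false, true) (q, true, true)).
    by apply: Or42; rewrite /= pe qe; split=> //; apply/eqP=> -[].
  apply: (@two_faces_interior _ (inr i, l, false) (inr i, l, true)).
  exact: Or44.
apply: (@two_faces_interior _ (p, l, true) (p, l, false)).
by apply: Or43; split=> //; apply/eqP=> -[].
Qed.

Lemma dual_cochain_cocycle x : rel_cocycle (dual_cochain x).
Proof.
split=> [[[p l] []]|[p|c|r|r] /boundary_edge_rim //]; rewrite !ffunE //=.
- by rewrite (core_jump x p l) subrK.
- by rewrite addr0.
Qed.

(** The cap product is carried by the rims and the spokes.  Pushing each rim across
    its rectangle, with its coefficient, moves it to the core; the two rims of an
    edge together leave there the difference of the heights on its two sides,
    and the spokes cancel at each corner. *)
Lemma cap_dual_cochain x : same_class (cap (dual_cochain x)) (core_chain x).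
Proof.
pose w p (l : bool) : int := (-1) ^+ l * corner_height x (corner_at p true l).
exists [ffun t : dface (sigma al) =>
  let: (p, l, is_lower) := t in if is_lower then - w p l else w p l].
apply/ffunP => -[q|c|[q l]|r]; rewrite !ffunE !big_sigma_face.
- rewrite [X in X - _ = _]big1 => [|p _]; last by rewrite !ffunE /=; ring.
  rewrite (bigD1 q) //= [X in _ = _ + X]big1 => [|p /negPf pq].
    have /= <- := corner_height_jump x q true.
    by rewrite !ffunE /w /= eqxx (_ : Posz true = 1) //; ring.
  rewrite !ffunE /= (_ : Posz (_ == _) = 0); first by ring.
  by rewrite (_ : (_ == _) = (p == q)) // pq.
- apply/eqP; rewrite subr0 eq_sym -subr_eq0 -sumrB; apply/eqP.
  rewrite -[RHS](corner_sum (fun d => corner_height x d * (Spoke d == Spoke c)%:Z)).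
  apply: eq_bigr => p _; rewrite !ffunE /=.
  rewrite {2}(core_jump x p false) /w /=; ring.
- rewrite subr0; apply: eq_bigr => p _; rewrite !ffunE /w /=; ring.
- rewrite subr0; apply: eq_bigr => p _; rewrite !ffunE /w /=; ring.
Qed.

Lemma core_chain_dual x : dual_to (dual_cochain x) (core_chain x).
Proof. by split; [exact: dual_cochain_cocycle | exact: cap_dual_cochain]. Qed.

(** The intersection number is the value of the dual of y on x.  On an edge this
    dual is the difference of the heights at both ends, on the left side, so that
    the sum over the edges can be rearranged into a sum over the vertices. *)
Lemma intersection_core x y :
  intersection (core_chain x) (core_chain y) =
  \sum_(e : arr al) (cyc_out x (inl (e, false)) * cyc_out y (inl (e, true)) -
                      cyc_in x (inl (e, true)) * cyc_in y (inl (e, false))).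
Proof.
have vxy : intersection_values (core_chain x) (core_chain y)
    (cup_eval (dual_cochain x) (dual_cochain y)).
  by exists (dual_cochain x), (dual_cochain y); split=> //; exact: core_chain_dual.
rewrite /intersection (xget_unique _ vxy) => [|n vn]; last first.
  exact: intersection_values_unique (@sigma_coherent _ al) vn vxy.
rewrite cup_evalE (evalc_same_class (dual_cochain_cocycle y) (cap_dual_cochain x)).
pose k o p := corner_height y (corner_at p o true).
transitivity (\sum_(p : cut al) (cyc_out x p * k true p - cyc_in x p * k false p)).
  transitivity (\sum_(p : cut al)
      (cyc_out x p * k true p - cyc_out x p * k false (next_cut p))).
    rewrite /evalc (reindex (@sigma_edge_decode _ al)); last first.
      by exists (@sigma_edge_code _ al) => [[[]|[]]|[]].
    rewrite big_sumType /= [X in _ + X]big1 ?addr0; last first.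
      by move=> [r|r] _; rewrite !ffunE mulr0.
    rewrite big_sumType /= [X in _ + X]big1 ?addr0 => [|c _]; last first.
      by rewrite !ffunE mulr0.
    by apply: eq_bigr => p _; rewrite !ffunE /k; ring.
  rewrite !sumrB; congr (_ - _).
  rewrite [RHS](reindex (@next_cut _ al)); last exact/onW_bij/next_cut_bij.
  by apply: eq_bigr => p _; rewrite cyc_next.
rewrite big_sumType /= [X in _ + X]big1 ?addr0 => [|i _]; last first.
  by rewrite /k /= !mulr0.
transitivity (\sum_(e : arr al) \sum_(b : bool)
  (cyc_out x (inl (e, b)) * k true (inl (e, b)) -
   cyc_in x (inl (e, b)) * k false (inl (e, b)))).
  by rewrite pair_bigA; apply: eq_bigr => -[].
(* Of the four corners at a crossing, the north-west one, of height 0, occurs twice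
   in this sum, next to the incoming tail and to the outgoing head. *)
by apply: eq_bigr => e _; rewrite big_bool /k /=; ring.
Qed.

End Core.

(** * The based matrix of a string and the cyclic order of its endpoints *)

Lemma index_next (T : eqType) (s : seq T) (p : T) : uniq s -> p \in s ->
  index (next s p) s =
  if ((index p s).+1 < size s)%N then (index p s).+1 else 0%N.
Proof.
move=> us ps; have -> : next s p = nth (head p s) s (index p s).+1.
  by rewrite next_nth ps; case: (s).
case: ltnP => [lt_i|le_i]; first by rewrite index_uniq.
by rewrite nth_default //; case: (s) ps => //= y ? _; rewrite eqxx.
Qed.

Section StringPairing.
Variables (R : realType) (al : vstring R).
Implicit Types (p q r : arr al * bool) (g h : option (arr al)).

Definition class_of g : arrow_class R := omap val g.

Lemma pos_inj : injective (@pos R al).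
Proof. exact: endpoints_distinct. Qed.

Lemma endpoint_seq_uniq : uniq (endpoint_seq al).
Proof. by rewrite sort_uniq enum_uniq. Qed.

Lemma mem_endpoint_seq p : p \in endpoint_seq al.
Proof. by rewrite mem_sort mem_enum. Qed.

Lemma before_index p q :
  before (pos p) (pos q) =
  (index p (endpoint_seq al) <= index q (endpoint_seq al))%N.
Proof.
set s := endpoint_seq al; pose le p q := angle (pos p) <= angle (pos q).
have le_index p' q' : (index p' s <= index q' s)%N -> le p' q'.
  apply: (sorted_leq_index (leT := le)); rewrite ?mem_endpoint_seq //.
  - by move=> ? ? ?; exact: le_trans.
  - by move=> ?; exact: lexx.
  - by apply: sort_sorted => ? ?; exact: le_total.
rewrite /before -/(le p q); congr (nat_of_bool _)%:Z.
apply/idP/idP => [lpq|/le_index //]; rewrite leqNgt; apply/negP => ltqp.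
have lqp := le_index _ _ (ltnW ltqp).
have : p = q by apply/pos_inj/val_inj/le_anti/andP.
by move=> pq; rewrite pq ltnn in ltqp.
Qed.

Lemma gap_next p r : gap (pos p) (pos (next (endpoint_seq al) p)) (pos r).
Proof.
rewrite /gap !before_index.
rewrite index_next ?endpoint_seq_uniq ?mem_endpoint_seq //.
have := mem_endpoint_seq p; have := mem_endpoint_seq r; rewrite -!index_mem.
move: (index p _) (index r _) (size _) => i j n jn ij.
case: ltnP => h; lia.
Qed.

(** A vertex that is crossed by the loop of another arrow is crossed straight on;
    only the loop of an arrow turns at the vertex of that arrow. *)
Lemma class_balance g (e : arr al) : balanced (val e) (class_of g).
Proof.
case: g => [f|//]; rewrite /class_of /=.
have [->|nef] := eqVneq e f; first by case: (fsval f) => a b; exact: arrow_balanced.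
have neq i j : pos (e, i) != pos (f, j) by apply: contra_neq nef => /pos_inj[].
move: (neq false false) (neq false true) (neq true false) (neq true true).
rewrite /pos /endpoint /balanced /=; case: (fsval f) => a b *.
by rewrite !flow_off.
Qed.

Lemma class_flow_next g p :
  flow_in (class_of g) (pos (next (endpoint_seq al) p)) =
  flow_out (class_of g) (pos p).
Proof.
case: g => [e|//]; rewrite /class_of /=; symmetry.
set q := next _ p; have : gap (pos p) (pos q) (val e).1 := gap_next p (e, false).
have : gap (pos p) (pos q) (val e).2 := gap_next p (e, true).
by rewrite /=; case: (fsval e) => a b gb ga; exact: flow_gap.
Qed.

(** An auxiliary cutting point exists only if there are no arrows, hence no class
    but that of the curve, whose multiplicity is 1. *)
Definition class_cycle_out g (p : cut al) : int :=
  if p is inl q then flow_out (class_of g) (pos q) else 1.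

Definition class_cycle_in g (p : cut al) : int :=
  if p is inl q then flow_in (class_of g) (pos q) else 1.

Lemma class_cycle_next g (c : cut al) :
  class_cycle_in g (next_cut c) = class_cycle_out g c.
Proof. by case: c => //= q; exact: class_flow_next. Qed.

Definition class_cycle g : graph_cycle al :=
  @GraphCycle R al (class_cycle_out g) (class_cycle_in g)
    (class_cycle_next g) (class_balance g).

Lemma aux_empty (e : arr al) (i : aux al) : False.
Proof.
have : val e \in arrows al := valP e.
move: (val e) => v; case: i => i; case: eqP => // /cardfs0_eq -> _ /=.
by rewrite inE.
Qed.

Lemma class_chain_core g : class_chain g = core_chain (class_cycle g).
Proof.
have core_sum (I : finType) (P : pred I) (k : I -> cut al) (f : dedge (sigma al)) :
    (\sum_(i | P i) edge_chain (Core (k i) : dedge (sigma al))) f =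
    \sum_(i | P i) (Core (k i) == f)%:Z.
  by rewrite sum_ffunE; apply: eq_bigr => i _; rewrite ffunE.
apply/ffunP => f; case: g => [e|];
  rewrite /class_chain /loop_chain /curve_chain core_sum ffunE.
  case: f => [[p|i]|c|r|r]; try by rewrite big1.
    rewrite /= [fsval e in RHS]surjective_pairing flow_out_arc.
    have [inp|ninp] := boolP (_ && _).
      rewrite (bigD1 p) //= eqxx big1 // => q /andP[_ /negPf qp].
      by rewrite (_ : (_ == _) = (q == p)) // qp.
    rewrite big1 // => q inq; rewrite (_ : (_ == _) = (q == p)) //.
    by have [qp|//] := eqVneq q p; rewrite -qp inq in ninp.
  by case: (aux_empty e i).
case: f => [p|c|r|r]; try by rewrite big1.
rewrite (bigD1 p) //= eqxx big1 => [|q /negPf qp].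
  by case: p.
by rewrite (_ : (_ == _) = (q == p)) // qp.
Qed.

Lemma string_bE g h :
  string_b g h = pairing (arrows al) (class_of g) (class_of h).
Proof.
rewrite /string_b !class_chain_core intersection_core /pairing.
by rewrite big_seq_fsetE.
Qed.

End StringPairing.

(** * Homologies from relabellings *)

Section Labels.
Variables (R : realType).
Implicit Types (al be : vstring R) (c : arrow_class R).

Definition is_class be c : bool :=
  if c is Some e then e \in arrows be else true.

(** T enumerates the basis elements of the based matrix of be.  Labels are pairs of
    points of the circle rather than elements of the type of arrows of be, which
    lets the arrows of two strings be compared. *)
Definition labelling be (T : Type) (l : T -> arrow_class R) : Prop :=
  [/\ injective l, forall t, is_class be (l t) &
      forall c, is_class be c -> exists t, l t = c].

Lemma class_of_inj al : injective (@class_of R al).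
Proof. by move=> [e|] [f|] //= [] /val_inj ->. Qed.

Lemma class_of_is_class al (g : option (arr al)) : is_class al (class_of g).
Proof. by case: g => [e|] //=; exact: (valP e). Qed.

Lemma class_of_surj al c : is_class al c -> exists g : option (arr al), class_of g = c.
Proof.
by case: c => [e /= ein|_]; [exists (Some [` ein]%fset) | exists None].
Qed.

Lemma labelling_bijection be (T : finType) (l : T -> arrow_class R) :
  labelling be l ->
  exists f : T -> option (arr be), bijective f /\ forall t, class_of (f t) = l t.
Proof.
move=> [l_inj l_in l_surj].
have [f fE] := boolp.choice (fun t => class_of_surj (l_in t)).
have f_inj : injective f by move=> t u ftu; apply: l_inj; rewrite -!fE ftu.
have [f' f'E] := boolp.choice
  (fun g : option (arr be) => l_surj _ (class_of_is_class g)).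
exists f; split=> //; exists f' => [t|g]; first by apply: l_inj; rewrite f'E fE.
by apply: class_of_inj; rewrite fE f'E.
Qed.

Lemma string_b_label be (T : Type) (l : T -> arrow_class R) (f : T -> option (arr be)) t u :
  (forall t, class_of (f t) = l t) ->
  string_b (f t) (f u) = pairing (arrows be) (l t) (l u).
Proof. by move=> fE; rewrite string_bE !fE. Qed.

Lemma homologous_relabel al be (l : option (arr al) -> arrow_class R) :
  labelling be l -> l None = None ->
  (forall g h, pairing (arrows be) (l g) (l h) =
               pairing (arrows al) (class_of g) (class_of h)) ->
  homologous (string_matrix al) (string_matrix be).
Proof.
move=> /labelling_bijection[f [f_bij fE]] l0 lb.
apply/rst_step/step_iso; exists f; split=> // [|g h].
  by apply: class_of_inj; rewrite fE.
by rewrite /= (string_b_label _ _ fE) lb string_bE.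
Qed.

Section Extension.
Variables (al be : vstring R) (T : finType) (new : T -> circle R * circle R).
Hypothesis (new_inj : injective new).
Hypothesis (new_notin : forall t, new t \notin arrows al).
Hypothesis (arrows_be :
  forall e, e \in arrows be <-> e \in arrows al \/ exists t, e = new t).
Hypothesis (old_pairing : forall g h : option (arr al),
  pairing (arrows be) (class_of g) (class_of h) =
  pairing (arrows al) (class_of g) (class_of h)).

Definition ext_class (g : option (arr al) + T) : arrow_class R :=
  match g with inl g => class_of g | inr t => Some (new t) end.

Lemma ext_class_labelling : labelling be ext_class.
Proof.
have new_neq (g : option (arr al)) t : class_of g <> Some (new t).
  by have := class_of_is_class g => + gE; rewrite gE /= (negPf (new_notin t)).
split.
- move=> [g|t] [h|u] /=; first by move=> /class_of_inj ->.
  + by move=> /new_neq.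
  + by move=> /esym/new_neq.
  + by move=> [/new_inj ->].
- case=> [g|t] /=; last by apply/arrows_be; right; exists t.
  by have := class_of_is_class g; case: (class_of g) => //= e ein; apply/arrows_be; left.
case=> [e /arrows_be[ein|[t ->]]|_]; last by exists (inl None).
  by exists (inl (Some [` ein]%fset)).
by exists (inr t).
Qed.

(** The extended matrix is transported from the matrix of be, which provides its
    skew symmetry; only the defining relations of the extension remain to be
    checked, on the combinatorial formula. *)
Lemma homologous_extension :
  (forall (c : string_matrix al + T -> string_matrix al + T -> int) (c_skew : skew c),
     extends c ->
     (forall g h, c g h = pairing (arrows be) (ext_class g) (ext_class h)) ->
     elementary_extension (string_matrix al)
      (@BasedMatrix (string_matrix al + T)%type (inl None) c c_skew)) ->
  homologous (string_matrix al) (string_matrix be).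
Proof.
move=> ext; have [f [f_bij fE]] := labelling_bijection ext_class_labelling.
pose c g h := string_b (f g) (f h).
have cE g h : c g h = pairing (arrows be) (ext_class g) (ext_class h).
  exact: string_b_label.
have c_skew : skew c by move=> g h; exact: string_b_skew.
apply: rst_trans (rst_step _ _ _ _ (step_extension (ext c c_skew _ cE))) _.
  by move=> g h; rewrite cE /= string_bE; exact: old_pairing.
apply/rst_step/step_iso; exists f; split=> //=.
by apply: class_of_inj; rewrite fE.
Qed.

End Extension.

End Labels.

(** * Homeomorphisms *)

Section Homeo.
Variable R : realType.
Implicit Types (a b x : circle R) (f : circle R -> circle R).

Lemma frac_eq (x y : R) (n : int) : 0 <= y < 1 -> x = y + n%:~R -> frac x = y.
Proof.
move=> /andP[y0 y1] ->; rewrite /frac (@floor_def _ _ n) ?addrK //.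
by rewrite intrD; apply/andP; split; lra.
Qed.

(** The lift F maps the fundamental domain that starts at a onto the one that
    starts at F a. *)
Lemma homeo_frac_sub f : circle_homeo f ->
  exists2 F : R -> R, {mono F : x y / x <= y} &
    forall a x, frac (angle (f x) - angle (f a)) =
                F (angle a + frac (angle x - angle a)) - F (angle a).
Proof.
move=> [F [_ F_incr F_shift fF]]; exists F; first exact: le_mono.
have f_angle x : exists n : int, angle (f x) = F (angle x) - n%:~R.
  have {1}-> : x = circle_cover (angle x).
    by apply: val_inj; rewrite /= (@frac_eq _ (angle x) 0) ?addr0 ?angle_itv.
  by rewrite fF /= /frac; exists (Num.floor (F (angle x))).
move=> a x; have [n ->] := f_angle x; have [m ->] := f_angle a.
have /andP[x0 x1] := angle_itv x; have /andP[a0 a1] := angle_itv a.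
have Fmono := le_mono F_incr.
have F_between y : angle a <= y < angle a + 1 -> 0 <= F y - F (angle a) < 1.
  move=> /andP[ay ya]; have := F_incr _ _ ya; rewrite -Fmono in ay.
  by rewrite F_shift => ?; apply/andP; split; lra.
rewrite frac_sub addrA [_ + (_ - _)]addrC subrK.
apply: (@frac_eq _ _ (m - n - (angle x < angle a)%R%:Z)).
  by apply: F_between; case: ltP => ? /=; apply/andP; split; lra.
rewrite !intrB; case: ltP => _ /=; rewrite ?F_shift ?addr0; lra.
Qed.

Lemma homeo_inj f : circle_homeo f -> injective f.
Proof.
move=> /homeo_frac_sub[F F_mono fF] a b fab.
have : frac (angle (f b) - angle (f a)) = frac (angle (f a) - angle (f a)).
  by rewrite fab.
by rewrite !fF => /addIr /(inc_inj F_mono) /addrI /frac_sub_inj.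
Qed.

Lemma homeo_flow_out f a b x : circle_homeo f ->
  flow_out (Some (f a, f b)) (f x) = flow_out (Some (a, b)) x.
Proof.
move=> /homeo_frac_sub[F F_mono fF].
by rewrite !flow_out_frac !fF ltrD2r (leW_mono F_mono) ltrD2l.
Qed.

Lemma homeo_flow_in f a b x : circle_homeo f ->
  flow_in (Some (f a, f b)) (f x) = flow_in (Some (a, b)) x.
Proof.
move=> fh; rewrite !flow_in_out homeo_flow_out //.
by rewrite !(inj_eq (homeo_inj fh)).
Qed.

Lemma string_homeo_homologous (al be : vstring R) :
  string_homeo al be -> homologous (string_matrix al) (string_matrix be).
Proof.
move=> [f [fh beE]]; have f_inj := homeo_inj fh.
pose fa (e : circle R * circle R) := (f e.1, f e.2).
have fa_inj : injective fa by move=> [a b] [c d] [/f_inj -> /f_inj ->].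
apply: (@homologous_relabel _ _ _ (fun g => omap fa (class_of g))) => //.
  split.
  - by move=> g h /(inj_omap fa_inj) /class_of_inj.
  - case=> [e|] //=; rewrite beE; apply/imfsetP; exists (val e) => //=; exact: valP.
  - case=> [e|_]; last by exists None.
    rewrite /= beE => /imfsetP[e' /= e'in ->]; exists (Some [` e'in]%fset) => //.
move=> g h; rewrite /pairing beE big_imfset /=; last by move=> ? ? _ _; exact: fa_inj.
apply: eq_bigr => e _.
have outE (k : option (arr al)) x :
    flow_out (omap fa (class_of k)) (f x) = flow_out (class_of k) x.
  by case: k => [k|//] /=; rewrite /fa homeo_flow_out // -surjective_pairing.
have inE (k : option (arr al)) x :
    flow_in (omap fa (class_of k)) (f x) = flow_in (class_of k) x.
  by case: k => [k|//] /=; rewrite /fa homeo_flow_in // -surjective_pairing.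
by rewrite /local_pairing !outE !inE.
Qed.

End Homeo.

(** * The moves (a) and (b) *)

Section Extensions.
Variable R : realType.
Implicit Types (a b p q x : circle R) (al be : vstring R) (n : circle R * circle R).

Lemma endpoints_notin al (A : set (circle R)) e :
  (A `&` endpoints al = set0)%classic -> e \in arrows al -> ~ A e.1 /\ ~ A e.2.
Proof.
move=> A0 ein; split=> Ae; apply: (setI0_notin A0 Ae).
  by exists ([` ein]%fset, false).
by exists ([` ein]%fset, true).
Qed.

Definition avoids p p' (c : arrow_class R) : Prop :=
  if c is Some (a, b) then ~ arc p p' a /\ ~ arc p p' b else True.

Lemma class_avoids al p p' (g : option (arr al)) :
  (arc p p' `&` endpoints al = set0)%classic -> avoids p p' (class_of g).
Proof.
move=> al0; case: g => [e|//]; have := endpoints_notin al0 (valP e).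
by rewrite /class_of /=; case: (fsval e).
Qed.

Lemma flow_avoids p p' (c : arrow_class R) : p != p' -> avoids p p' c ->
  [/\ flow_out c p' = flow_out c p, flow_in c p = flow_out c p &
      flow_in c p' = flow_out c p].
Proof.
move=> pp'; case: c => [[a b]|//] /= [/(not_arc_before pp')[ap ap' app']].
move=> /(not_arc_before pp')[bp bp' bpp'].
have outE : flow_out (Some (a, b)) p' = flow_out (Some (a, b)) p.
  by rewrite /flow_out app' bpp'; ring.
by rewrite !flow_off ?outE // eq_sym.
Qed.

Lemma arrow_flow_off a b x : a != b -> ~ arc a b x ->
  flow_out (Some (a, b)) x = 0 /\ flow_in (Some (a, b)) x = 0.
Proof.
move=> ab /(not_arc_before ab)[xa xb xab].
rewrite flow_off // /flow_out (before_neq xa) (before_neq xb) xab.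
by split; ring.
Qed.

Lemma pairingU1 n (A : {fset circle R * circle R}) (g h : arrow_class R) :
  n \notin A ->
  pairing (n |` A)%fset g h = local_pairing n g h + pairing A g h.
Proof. by move=> nA; rewrite /pairing big_fsetU1. Qed.

(** The loop of the new arrow is the short arc ab itself: it meets no other
    crossing, and at its own one it pairs with h to the difference of the
    multiplicities of h at both ends of ab, which is 0. *)
Lemma move_a_homologous al be :
  move_a al be -> homologous (string_matrix al) (string_matrix be).
Proof.
move=> [a [b [ab al0 beE]]].
have new_notin : (a, b) \notin arrows al.
  by apply/negP => /(endpoints_notin al0)[/(_ (arc_src _ _))].
have new_inj : injective (fun _ : unit => (a, b)) by case=> -[].
have new_be e : e \in arrows be <-> e \in arrows al \/ exists t : unit, e = (a, b).
  rewrite beE; split=> [/fset1UP[->|ein]|[ein|[_ ->]]]; rewrite ?fset1U1 ?fset1Ur //.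
    by right; exists tt.
  by left.
apply: (homologous_extension new_inj (fun=> new_notin) new_be) => [g h|c c_skew c_ext cE].
  rewrite beE pairingU1 // /local_pairing /=.
  have [_ _ ->] := flow_avoids ab (class_avoids g al0).
  have [-> -> _] := flow_avoids ab (class_avoids h al0).
  by rewrite mulrC subrr add0r.
apply: ext_M1 => // h; rewrite cE beE pairingU1 //=.
rewrite /pairing big_seq big1 ?addr0 => [|e ein]; last first.
  have [e1 e2] := endpoints_notin al0 ein; rewrite /local_pairing.
  have [-> _] := arrow_flow_off ab e1; have [_ ->] := arrow_flow_off ab e2.
  by rewrite !mul0r subrr.
rewrite /local_pairing [flow_out (Some _) a]/flow_out [flow_in (Some _) b]/flow_in.
rewrite !before_refl (before_neq ab).
case: h => [h|_] /=.
  have [-> -> _] := flow_avoids ab (class_avoids h al0); ring.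
by rewrite /flow_out /flow_in !before_refl; ring.
Qed.

(** Up to corrections along the two arcs, the loops from a to b and from b' to a'
    cover the circle once, whatever the orientations of the arcs. *)
Lemma opposite_arrows_off p p' q q' a a' b b' x :
  p != p' -> q != q' -> (arc p p' `&` arc q q' = set0)%classic ->
  (a, a') = (p, p') \/ (a, a') = (p', p) ->
  (b, b') = (q, q') \/ (b, b') = (q', q) ->
  ~ arc p p' x -> ~ arc q q' x ->
  flow_out (Some (a, b)) x + flow_out (Some (b', a')) x = 1 /\
  flow_in (Some (a, b)) x + flow_in (Some (b', a')) x = 1.
Proof.
move=> pp' qq' dis aE bE.
move=> /(not_arc_before pp')[xp xp' xpp'] /(not_arc_before qq')[xq xq' xqq'].
have [e1 e2 e3 e4 [e5 e6 e7 e8 e9]] := disjoint_arcs_before pp' qq' dis.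
have outE : flow_out (Some (a, b)) x + flow_out (Some (b', a')) x = 1.
  move: (before_neq xp) (before_neq xp') (before_neq xq) (before_neq xq').
  by case: aE bE => [[-> ->]|[-> ->]] [[-> ->]|[-> ->]]; rewrite /flow_out => *; lra.
split=> //.
by case: aE bE outE => [[-> ->]|[-> ->]] [[-> ->]|[-> ->]]; rewrite !flow_off.
Qed.

(** The corrections along the two arcs pair with h to a combination of the defects
    of h, namely of its changes along the arcs and of its balances at the two new
    crossings, and these vanish. *)
Lemma opposite_arrows_pairing p p' q q' a a' b b' (h : arrow_class R) :
  p != p' -> q != q' -> (arc p p' `&` arc q q' = set0)%classic ->
  (a, a') = (p, p') \/ (a, a') = (p', p) ->
  (b, b') = (q, q') \/ (b, b') = (q', q) ->
  flow_out h p = flow_in h p' -> flow_out h q = flow_in h q' ->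
  balanced (a, b) h -> balanced (b', a') h ->
  local_pairing (a, b) (Some (a, b)) h + local_pairing (b', a') (Some (a, b)) h +
  (local_pairing (a, b) (Some (b', a')) h + local_pairing (b', a') (Some (b', a')) h) =
  local_pairing (a, b) None h + local_pairing (b', a') None h.
Proof.
move=> pp' qq' dis aE bE hp hq; rewrite /balanced /local_pairing /=.
have [e1 e2 e3 e4 [e5 e6 e7 e8 e9]] := disjoint_arcs_before pp' qq' dis.
set Oh := flow_out h; set Ih := flow_in h; rewrite -/Oh -/Ih in hp hq *.
by case: aE bE => [[-> ->]|[-> ->]] [[-> ->]|[-> ->]] bal1 bal2;
  rewrite /flow_out /flow_in !before_refl ?e1 ?e2 ?e3 ?e4 ?e5 ?e6 ?e7 ?e8 ?e9; lra.
Qed.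

Lemma class_flow_gap al (g : arrow_class R) p q :
  (forall e, e \in arrows al -> gap p q e.1 /\ gap p q e.2) ->
  is_class al g -> flow_out g p = flow_in g q.
Proof. by case: g => [[a b]|//] gapE /gapE[]; exact: flow_gap. Qed.

Lemma class_balanced al (g : arrow_class R) n :
  n \in arrows al -> is_class al g -> balanced n g.
Proof. by move=> nin /class_of_surj[h <-]; exact: (class_balance h [` nin]%fset). Qed.

Lemma move_b_homologous al be :
  move_b al be -> homologous (string_matrix al) (string_matrix be).
Proof.
move=> [p [p' [q [q' [pp' qq' [dis pal qal] [a [a' [b [b' [aE bE beE]]]]]]]]]].
have [pa pa'] : arc p p' a /\ arc p p' a'.
  by case: aE => [[-> ->]|[-> ->]]; split; (exact: arc_src || exact: arc_tgt).
have [qb qb'] : arc q q' b /\ arc q q' b'.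
  by case: bE => [[-> ->]|[-> ->]]; split; (exact: arc_src || exact: arc_tgt).
have n1al : (a, b) \notin arrows al by apply/negP => /(endpoints_notin pal)[].
have n2al : (b', a') \notin arrows al by apply/negP => /(endpoints_notin qal)[].
have n12 : (a, b) != (b', a').
  by apply/eqP => -[ab' _]; rewrite -ab' in qb'; exact: (setI0_notin dis pa qb').
have pairing_be g h :
    pairing (arrows be) g h =
    local_pairing (a, b) g h + local_pairing (b', a') g h + pairing (arrows al) g h.
  by rewrite beE -fsetUA !pairingU1 ?addrA // in_fset1U negb_or n12.
have be_arrow e : e \in arrows be <-> e = (a, b) \/ e = (b', a') \/ e \in arrows al.
  rewrite beE -fsetUA !in_fset1U.
  by split=> [/orP[/eqP ->|/orP[/eqP ->|]]|[->|[->|->]]];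
    rewrite ?eqxx ?orbT; auto.
pose new i := if i then (b', a') else (a, b).
have new_inj : injective new.
  by move=> [] [] // => [/esym/eqP|/eqP]; rewrite (negPf n12).
have new_notin i : new i \notin arrows al by case: i.
have new_be e : e \in arrows be <-> e \in arrows al \/ exists i, e = new i.
  rewrite be_arrow; split=> [[->|[->|]]|[|[[] ->]]]; auto; right.
    by exists false.
  by exists true.
apply: (homologous_extension new_inj new_notin new_be) => [g h|c c_skew c_ext cE].
- rewrite pairing_be /local_pairing /=.
  have [gp gp1 gp2] := flow_avoids pp' (class_avoids g pal).
  have [gq gq1 gq2] := flow_avoids qq' (class_avoids g qal).
  have [hp hp1 hp2] := flow_avoids pp' (class_avoids h pal).
  have [hq hq1 hq2] := flow_avoids qq' (class_avoids h qal).
  by case: aE bE => [[-> ->]|[-> ->]] [[-> ->]|[-> ->]];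
    rewrite ?gp ?gp1 ?gp2 ?gq ?gq1 ?gq2 ?hp ?hp1 ?hp2 ?hq ?hq1 ?hq2; ring.
apply: ext_M3 => // g; rewrite !cE !pairing_be /=.
set h := ext_class _ g.
have h_in : is_class be h.
  have [_ h_in _] := ext_class_labelling new_inj new_notin new_be; exact: h_in.
have gap_be e : e \in arrows be ->
    (gap p p' e.1 /\ gap p p' e.2) /\ (gap q q' e.1 /\ gap q q' e.2).
  have disC : (arc q q' `&` arc p p' = set0)%classic by rewrite setIC.
  have [ga ga'] : (gap p p' a /\ gap q q' a) /\ (gap p p' a' /\ gap q q' a').
    by split; apply: disjoint_arcs_gap => //; case: aE => -[]; auto.
  have [gb gb'] : (gap p p' b /\ gap q q' b) /\ (gap p p' b' /\ gap q q' b').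
    by split; apply/and_comm/disjoint_arcs_gap => //; case: bE => -[]; auto.
  case/be_arrow => [->|[->|ein]].
  - by case: ga gb => ? ? [].
  - by case: ga' gb' => ? ? [].
  have [? ?] := endpoints_notin pal ein; have [? ?] := endpoints_notin qal ein.
  by split; split; exact: not_arc_gap.
have hp := class_flow_gap (fun e ein => (gap_be e ein).1) h_in.
have hq := class_flow_gap (fun e ein => (gap_be e ein).2) h_in.
have h1 : balanced (a, b) h.
  by apply: class_balanced h_in; apply/be_arrow; left.
have h2 : balanced (b', a') h.
  by apply: class_balanced h_in; apply/be_arrow; right; left.
have := opposite_arrows_pairing pp' qq' dis aE bE hp hq h1 h2.
have : pairing (arrows al) (Some (a, b)) h + pairing (arrows al) (Some (b', a')) h =
       pairing (arrows al) None h.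
  rewrite /pairing -big_split /=; apply: eq_big_seq => e ein.
  have [p1 p2] := endpoints_notin pal ein; have [q1 q2] := endpoints_notin qal ein.
  have [o1 _] := opposite_arrows_off pp' qq' dis aE bE p1 q1.
  have [_ i2] := opposite_arrows_off pp' qq' dis aE bE p2 q2.
  rewrite /local_pairing.
  (* The multiplicity 1 of the curve is the sum of those of both loops. *)
  rewrite [RHS](_ : _ = 1 * flow_out h e.2 - 1 * flow_in h e.1) // -{1}o1 -i2; ring.
lra.
Qed.

End Extensions.

(** * The move (c) *)

Section Triangle.
Variable R : realType.
Implicit Types (a b c x : circle R) (al : vstring R) (e f : circle R * circle R).

(** The two sums are the contributions of the three crossings before and after the
    move, for two cycles that enter the side at a with multiplicities Ai and ai,
    run along it with A (At after the move) and k, and leave it at a' with Ao and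
    ao; likewise at b and c.  By the balances at the crossings, both sums are
    functions of the multiplicities outside the triangle: adding the same
    integer to A, B, C, that is, adding the boundary of the triangle, has no
    effect. *)
Lemma triangle_identity (Ai A Ao At Bi B Bo Bt Ci C Co Ct : int)
    (ai k ao bi l bo ci m co : int) :
  Ao + B = A + Bi -> Bo + C = B + Ci -> Co + A = C + Ai ->
  At + Bo = Ai + Bt -> Bt + Co = Bi + Ct ->
  ao + l = k + bi -> bo + m = l + ci -> co + k = m + ai ->
  (At * bo - Bt * ai) + ((Bt * co - Ct * bi) + (Ct * ao - At * ci)) =
  (Ao * l - Bi * k) + ((Bo * m - Ci * l) + (Co * k - Ai * m)).
Proof.
move=> g1 g2 g3 g1' g2' h1 h2 h3.
have -> : Ct = Bt + Co - Bi by lra.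
have -> : Bt = At + Bo - Ai by lra.
have -> : Ao = A + Bi - B by lra.
have -> : Bo = B + Ci - C by lra.
have -> : Co = C + Ai - A by lra.
have -> : ao = k + bi - l by lra.
have -> : bo = l + ci - m by lra.
have -> : co = m + ai - k by lra.
ring.
Qed.

Lemma slide_flows a a' b b' : a != a' -> b != b' ->
  (arc a a' `&` arc b b' = set0)%classic ->
  let g := Some (a', b) in let g' := Some (a, b') in
  [/\ forall x, ~ arc a a' x -> ~ arc b b' x ->
        flow_out g' x = flow_out g x /\ flow_in g' x = flow_in g x,
      flow_in g' a = flow_in g a, flow_out g' a' = flow_out g a',
      flow_in g' b = flow_in g b & flow_out g' b' = flow_out g b'].
Proof.
move=> aa' bb' dis g g'; rewrite {}/g {}/g'.
have [e1 e2 e3 e4 [e5 e6 e7 e8 e9]] := disjoint_arcs_before aa' bb' dis.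
split; last first.
1-4: rewrite /flow_in /flow_out !before_refl.
1-4: by rewrite ?e1 ?e2 ?e3 ?e4 ?e5 ?e6 ?e7 ?e8 ?e9; ring.
move=> x /(not_arc_before aa')[xa xa' xaa'] /(not_arc_before bb')[xb xb' xbb'].
have outE : flow_out (Some (a, b')) x = flow_out (Some (a', b)) x.
  rewrite /flow_out (before_neq xa) (before_neq xa') (before_neq xb) (before_neq xb').
  by rewrite xaa' xbb' e5 e6; ring.
by rewrite !flow_off.
Qed.

Lemma endpoint_inj al e f i j :
  e \in arrows al -> f \in arrows al -> endpoint e i = endpoint f j ->
  (e, i) = (f, j).
Proof.
move=> ein fin ef; have pq := @pos_inj R al ([` ein]%fset, i) ([` fin]%fset, j) ef.
by have /= := congr1 (fun p : arr al * bool => (val p.1, p.2)) pq.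
Qed.

(** The cycles of g and g' differ at most on the arcs listed in s. *)
Definition slides (s : seq (circle R * circle R)) (g g' : arrow_class R) : Prop :=
  (forall x, (forall t, t \in s -> ~ arc t.1 t.2 x) ->
    flow_out g' x = flow_out g x /\ flow_in g' x = flow_in g x) /\
  (forall t, t \in s ->
    flow_in g' t.1 = flow_in g t.1 /\ flow_out g' t.2 = flow_out g t.2).

Lemma slides_refl s g : slides s g g.
Proof. by split. Qed.

Lemma slides_eq s t g g' : s =i t -> slides s g g' -> slides t g g'.
Proof.
by move=> st [far near]; split=> [x xt|u ut];
  [apply: far => u us; apply: xt|apply: near]; rewrite ?st // -st.
Qed.

Lemma slides_arrow a a' b b' c c' : a != a' -> b != b' ->
  (arc a a' `&` arc b b' = set0)%classic ->
  (arc b b' `&` arc c c' = set0)%classic ->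
  (arc c c' `&` arc a a' = set0)%classic ->
  slides [:: (a, a'); (b, b'); (c, c')] (Some (a', b)) (Some (a, b')).
Proof.
move=> aa' bb' ab bc ca; have [far ina outa' inb outb'] := slide_flows aa' bb' ab.
have cb : (arc c c' `&` arc b b' = set0)%classic by rewrite setIC.
have far_c x : arc c c' x -> flow_out (Some (a, b')) x = flow_out (Some (a', b)) x /\
    flow_in (Some (a, b')) x = flow_in (Some (a', b)) x.
  by move=> cx; apply: far; apply: (setI0_notin _ cx).
split=> [x off|t].
  by apply: far; [apply: (off (a, a'))|apply: (off (b, b'))]; rewrite !inE eqxx ?orbT.
rewrite !inE => /or3P[] /eqP -> //=.
by have [_ ->] := far_c _ (arc_src c c'); have [-> _] := far_c _ (arc_tgt c c').
Qed.

End Triangle.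

Section TriangleMove.
Variables (R : realType) (al be : vstring R) (a a' b b' c c' : circle R).
Implicit Types (e f : circle R * circle R) (x : circle R) (g h k : option (arr al)).

Local Notation old1 := (a', b).
Local Notation old2 := (b', c).
Local Notation old3 := (c', a).
Local Notation new1 := (a, b').
Local Notation new2 := (b, c').
Local Notation new3 := (c, a').
Local Notation sides := [:: (a, a'); (b, b'); (c, c')].
Local Notation kept := (arrows al `\` [fset old1; old2; old3])%fset.

Hypotheses (old1_in : old1 \in arrows al) (old2_in : old2 \in arrows al).
Hypothesis old3_in : old3 \in arrows al.
Hypothesis ab : (arc a a' `&` arc b b' = set0)%classic.
Hypothesis bc : (arc b b' `&` arc c c' = set0)%classic.
Hypothesis ca : (arc c c' `&` arc a a' = set0)%classic.
Hypothesis sides_free : ((arc a a' `|` arc b b' `|` arc c c') `&`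
  (endpoints al `\` [set x | x \in [:: a; a'; b; b'; c; c']]) = set0)%classic.
Hypothesis beE : arrows be = ([fset new1; new2; new3] `|` kept)%fset.

Let tail_head e f : e \in arrows al -> f \in arrows al -> e.1 != f.2.
Proof.
by move=> ein fin; apply/eqP => /(endpoint_inj (i := false) (j := true) ein fin).
Qed.

(* The point a' is the tail of an arrow and a the head of another. *)
Let aa' : a != a'. Proof. by rewrite eq_sym; exact: (tail_head old1_in old3_in). Qed.
Let bb' : b != b'. Proof. by rewrite eq_sym; exact: (tail_head old2_in old1_in). Qed.
Let cc' : c != c'. Proof. by rewrite eq_sym; exact: (tail_head old3_in old2_in). Qed.

Let ba : (arc b b' `&` arc a a' = set0)%classic. Proof. by rewrite setIC. Qed.
Let cb : (arc c c' `&` arc b b' = set0)%classic. Proof. by rewrite setIC. Qed.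
Let ac : (arc a a' `&` arc c c' = set0)%classic. Proof. by rewrite setIC. Qed.

Lemma old_neq : [/\ old1 != old2, old2 != old3 & old3 != old1].
Proof.
have [[_ na'b'] [_ nb'c'] [_ nc'a']] := And3 (disjoint_arcs_neq ab)
  (disjoint_arcs_neq bc) (disjoint_arcs_neq ca).
by rewrite -!pair_eqE /pair_eq /= (negPf na'b') (negPf nb'c') (negPf nc'a').
Qed.

Lemma new_neq : [/\ new1 != new2, new2 != new3 & new3 != new1].
Proof.
have [[nab _] [nbc _] [nca _]] := And3 (disjoint_arcs_neq ab)
  (disjoint_arcs_neq bc) (disjoint_arcs_neq ca).
by rewrite -!pair_eqE /pair_eq /= (negPf nab) (negPf nbc) (negPf nca).
Qed.

(* The tail of each new arrow is the head of an old one. *)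
Lemma new_notin :
  [/\ new1 \notin arrows al, new2 \notin arrows al & new3 \notin arrows al].
Proof.
have notin e f : f.1 = e.2 -> e \in arrows al -> f \notin arrows al.
  by move=> fe ein; apply/negP => fin; have := tail_head fin ein; rewrite fe eqxx.
by split; [exact: (notin old3)|exact: (notin old1)|exact: (notin old2)].
Qed.

Lemma keptP e :
  reflect [/\ e \in arrows al, e != old1, e != old2 & e != old3] (e \in kept).
Proof. by rewrite in_fsetD !inE !negb_or -!andbA; apply: (iffP and4P) => -[]. Qed.

Lemma al_arrows : arrows al = (old1 |` (old2 |` (old3 |` kept)))%fset.
Proof.
apply/fsetP => e; rewrite !in_fset1U; apply/idP/idP => [ein|].
  case: eqVneq => //= ne1; case: eqVneq => //= ne2; case: eqVneq => //= ne3.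
  by apply/keptP.
by case/or4P => [/eqP ->|/eqP ->|/eqP ->|/keptP[]].
Qed.

Lemma al_arrow_cases e :
  e \in arrows al -> [\/ e = old1, e = old2, e = old3 | e \in kept].
Proof.
rewrite {1}al_arrows !in_fset1U.
by case/or4P => [/eqP|/eqP|/eqP|]; [apply: Or41|apply: Or42|apply: Or43|apply: Or44].
Qed.

Lemma be_arrows : arrows be = (new1 |` (new2 |` (new3 |` kept)))%fset.
Proof. by rewrite beE !fsetUA. Qed.

Lemma notin_kept f : f \notin arrows al -> f \notin kept.
Proof. by apply: contraNN => /keptP[]. Qed.

Lemma al_pairing (g h : arrow_class R) : pairing (arrows al) g h =
  local_pairing old1 g h + (local_pairing old2 g h + local_pairing old3 g h) +
  pairing kept g h.
Proof.
have [n12 n23 n31] := old_neq.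
rewrite {1}al_arrows !pairingU1 ?in_fset1U ?negb_or -?addrA //.
- by apply/keptP => -[_ _ _]; rewrite eqxx.
- by rewrite n23; apply/keptP => -[_ _]; rewrite eqxx.
- by rewrite n12 eq_sym n31; apply/keptP => -[_]; rewrite eqxx.
Qed.

Lemma be_pairing (g h : arrow_class R) : pairing (arrows be) g h =
  local_pairing new1 g h + (local_pairing new2 g h + local_pairing new3 g h) +
  pairing kept g h.
Proof.
have [n12 n23 n31] := new_neq; have [n1 n2 n3] := new_notin.
rewrite be_arrows !pairingU1 ?in_fset1U ?negb_or -?addrA ?n12 ?n23 ?notin_kept //.
by rewrite eq_sym n31.
Qed.

Lemma kept_off e i : e \in kept ->
  forall t, t \in sides -> ~ arc t.1 t.2 (endpoint e i).
Proof.
move=> /keptP[ein ne1 ne2 ne3] t tin arc_t.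
have x_end : endpoints al (endpoint e i) by exists ([` ein]%fset, i).
have x_far : ~ endpoint e i \in [:: a; a'; b; b'; c; c'].
  have ne f j : f \in arrows al -> e != f -> endpoint e i != endpoint f j.
    by move=> fin /eqP nef; apply/eqP => /(endpoint_inj ein fin)[].
  rewrite !inE => /or4P[|||/or3P[]]; apply/negP.
  - exact: (ne old3 true).
  - exact: (ne old1 false).
  - exact: (ne old1 true).
  - exact: (ne old2 false).
  - exact: (ne old2 true).
  - exact: (ne old3 false).
apply: (setI0_notin sides_free _ (conj x_end x_far)).
by move: tin arc_t; rewrite !inE => /or3P[] /eqP -> /= ?;
  [left; left|left; right|right].
Qed.

Let side_gap x := forall t, t \in sides -> gap t.1 t.2 x.

Let side_gapI x : gap a a' x -> gap b b' x -> gap c c' x -> side_gap x.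
Proof. by move=> ? ? ? t; rewrite !inE => /or3P[] /eqP ->. Qed.

Lemma sides_gap : [/\ side_gap a /\ side_gap a', side_gap b /\ side_gap b' &
  side_gap c /\ side_gap c'].
Proof.
have [gA gB gC] := And3
  (fun x => conj (@disjoint_arcs_gap _ _ _ _ _ x aa' bb' ab)
                 (@disjoint_arcs_gap _ _ _ _ _ x aa' cc' ac))
  (fun x => conj (@disjoint_arcs_gap _ _ _ _ _ x bb' aa' ba)
                 (@disjoint_arcs_gap _ _ _ _ _ x bb' cc' bc))
  (fun x => conj (@disjoint_arcs_gap _ _ _ _ _ x cc' aa' ca)
                 (@disjoint_arcs_gap _ _ _ _ _ x cc' bb' cb)).
have {}gA x : x = a \/ x = a' -> side_gap x.
  by case: (gA x) => h1 h2 xE; have [? ?] := h1 xE; have [? ?] := h2 xE; exact: side_gapI.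
have {}gB x : x = b \/ x = b' -> side_gap x.
  by case: (gB x) => h1 h2 xE; have [? ?] := h1 xE; have [? ?] := h2 xE; exact: side_gapI.
have {}gC x : x = c \/ x = c' -> side_gap x.
  by case: (gC x) => h1 h2 xE; have [? ?] := h1 xE; have [? ?] := h2 xE; exact: side_gapI.
by split; split; auto.
Qed.

Lemma kept_gap e : e \in kept -> side_gap e.1 /\ side_gap e.2.
Proof.
move=> ek; have neq t : t \in sides -> t.1 != t.2.
  by rewrite !inE => /or3P[] /eqP ->.
split=> t tin.
  exact: (not_arc_gap (neq _ tin) (kept_off (i := false) ek tin)).
exact: (not_arc_gap (neq _ tin) (kept_off (i := true) ek tin)).
Qed.

Lemma al_gap e : e \in arrows al -> side_gap e.1 /\ side_gap e.2.
Proof.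
have [[? ?] [? ?] [? ?]] := sides_gap.
by rewrite al_arrows !in_fset1U => /or4P[/eqP ->|/eqP ->|/eqP ->|/kept_gap].
Qed.

Lemma be_gap e : e \in arrows be -> side_gap e.1 /\ side_gap e.2.
Proof.
have [[? ?] [? ?] [? ?]] := sides_gap.
by rewrite be_arrows !in_fset1U => /or4P[/eqP ->|/eqP ->|/eqP ->|/kept_gap].
Qed.

Definition slide e :=
  if e == old1 then new1 else if e == old2 then new2 else
  if e == old3 then new3 else e.

Lemma slideE : [/\ slide old1 = new1, slide old2 = new2, slide old3 = new3 &
  forall e, e \in kept -> slide e = e].
Proof.
have [n12 n23 n31] := old_neq; split=> [|||e /keptP[_ /negPf n1 /negPf n2 /negPf n3]].
- by rewrite /slide eqxx.
- by rewrite /slide eq_sym (negPf n12) eqxx.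
- by rewrite /slide (negPf n31) eq_sym (negPf n23) eqxx.
- by rewrite /slide n1 n2 n3.
Qed.

Lemma slide_inj : {in arrows al &, injective slide}.
Proof.
have [s1 s2 s3 sk] := slideE; have [/eqP n12 /eqP n23 /eqP n31] := new_neq.
have kept_new e : e \in kept -> [/\ e <> new1, e <> new2 & e <> new3].
  have [n1 n2 n3] := new_notin.
  by move=> ek; split=> eE; move: ek; rewrite eE; apply/negP/notin_kept.
move=> e f /al_arrow_cases + /al_arrow_cases.
move=> [->|->|->|ek] [->|->|->|fk]; rewrite ?s1 ?s2 ?s3 ?sk // => eq_slide.
all: try by have [] := kept_new _ fk; rewrite -eq_slide.
all: try by have [] := kept_new _ ek; rewrite eq_slide.
all: by exfalso; auto.
Qed.

Let slide_class g : arrow_class R := omap slide (class_of g).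

Lemma slide_labelling : labelling be slide_class.
Proof.
have [s1 s2 s3 sk] := slideE; split.
- by move=> [e|] [f|] //= [] ef; congr Some; apply/val_inj/slide_inj;
    rewrite ?(valP e) ?(valP f).
- case=> [e|//]; rewrite /slide_class /= be_arrows !in_fset1U.
  by case: (al_arrow_cases (valP e)) => /= [->|->|->|ek];
    rewrite ?s1 ?s2 ?s3 ?sk // ?eqxx ?ek ?orbT.
- case=> [e|_]; last by exists None.
  have slide_of f (fin : f \in arrows al) :
    slide_class (Some [` fin]%fset) = Some (slide f) by [].
  rewrite /= be_arrows !in_fset1U => /or4P[/eqP ->|/eqP ->|/eqP ->|ek].
  + by exists (Some [` old1_in]%fset); rewrite slide_of s1.
  + by exists (Some [` old2_in]%fset); rewrite slide_of s2.
  + by exists (Some [` old3_in]%fset); rewrite slide_of s3.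
  + have /keptP[ein _ _ _] := ek.
    by exists (Some [` ein]%fset); rewrite slide_of sk.
Qed.

Lemma slide_class_slides g : slides sides (class_of g) (slide_class g).
Proof.
case: g => [e|]; last exact: slides_refl.
have [s1 s2 s3 sk] := slideE.
rewrite /slide_class /=; case: (al_arrow_cases (valP e)) => /= [->|->|->|ek].
- by rewrite s1; exact: slides_arrow.
- rewrite s2; apply: slides_eq (slides_arrow bb' cc' bc ca ab).
  by move=> t; rewrite !inE [LHS]orbA [LHS]orbC.
- rewrite s3; apply: slides_eq (slides_arrow cc' aa' ca ab bc).
  by move=> t; rewrite !inE [LHS]orbC -orbA.
- by rewrite sk //; exact: slides_refl.
Qed.

Lemma slide_class_pairing g h :
  pairing (arrows be) (slide_class g) (slide_class h) =
  pairing (arrows al) (class_of g) (class_of h).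
Proof.
rewrite be_pairing al_pairing; congr (_ + _); last first.
  apply: eq_big_seq => e ek; rewrite /local_pairing.
  have [farg _] := slide_class_slides g; have [farh _] := slide_class_slides h.
  have tail_off := kept_off (i := false) ek; have head_off := kept_off (i := true) ek.
  have [-> _] := farg _ tail_off; have [_ ->] := farh _ tail_off.
  by have [_ ->] := farg _ head_off; have [-> _] := farh _ head_off.
have [_ is_slide_class _] := slide_labelling.
have flow_al k t : t \in sides ->
    flow_in (class_of k) t.2 = flow_out (class_of k) t.1.
  move=> tin; symmetry; apply: (class_flow_gap _ (class_of_is_class k)) => e.
  by move=> /al_gap[e1 e2]; split; [exact: e1 | exact: e2].
have flow_be k t : t \in sides ->
    flow_in (slide_class k) t.2 = flow_out (slide_class k) t.1.
  move=> tin; symmetry; apply: (class_flow_gap _ (is_slide_class k)) => e.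
  by move=> /be_gap[e1 e2]; split; [exact: e1 | exact: e2].
have [ta tb tc] : [/\ (a, a') \in sides, (b, b') \in sides & (c, c') \in sides].
  by rewrite !inE !eqxx !orbT.
have al_sides k :
  [/\ flow_in (class_of k) a' = flow_out (class_of k) a,
      flow_in (class_of k) b' = flow_out (class_of k) b &
      flow_in (class_of k) c' = flow_out (class_of k) c].
  by split; [exact: flow_al ta|exact: flow_al tb|exact: flow_al tc].
have be_sides k :
  [/\ flow_in (slide_class k) a' = flow_out (slide_class k) a,
      flow_in (slide_class k) b' = flow_out (slide_class k) b &
      flow_in (slide_class k) c' = flow_out (slide_class k) c].
  by split; [exact: flow_be ta|exact: flow_be tb|exact: flow_be tc].
have slide_in k :
  [/\ flow_in (slide_class k) a = flow_in (class_of k) a,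
      flow_in (slide_class k) b = flow_in (class_of k) b &
      flow_in (slide_class k) c = flow_in (class_of k) c].
  have [_ near] := slide_class_slides k.
  by split; [exact: (near _ ta).1|exact: (near _ tb).1|exact: (near _ tc).1].
have slide_out k :
  [/\ flow_out (slide_class k) a' = flow_out (class_of k) a',
      flow_out (slide_class k) b' = flow_out (class_of k) b' &
      flow_out (slide_class k) c' = flow_out (class_of k) c'].
  have [_ near] := slide_class_slides k.
  by split; [exact: (near _ ta).2|exact: (near _ tb).2|exact: (near _ tc).2].
have bal_al k : [/\ balanced old1 (class_of k), balanced old2 (class_of k) &
                    balanced old3 (class_of k)].
  by split; apply: class_balanced (class_of_is_class k).
have bal_be k : balanced new1 (slide_class k) /\ balanced new2 (slide_class k).
  by split; apply: class_balanced (is_slide_class k);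
    rewrite be_arrows !in_fset1U eqxx ?orbT.
move: (al_sides g) (be_sides g) (slide_in g) (slide_out g) (bal_al g) (bal_be g).
move: (al_sides h) (slide_in h) (slide_out h) (bal_al h).
rewrite /balanced /local_pairing /=.
move=> [-> -> ->] [-> -> ->] [-> -> ->] [h1 h2 h3].
move=> [-> -> ->] [-> -> ->] [-> -> _] [_ -> ->] [g1 g2 g3] [g1' g2'].
exact: triangle_identity g1 g2 g3 g1' g2' h1 h2 h3.
Qed.

Lemma triangle_move_homologous : homologous (string_matrix al) (string_matrix be).
Proof. exact: homologous_relabel slide_labelling erefl slide_class_pairing. Qed.

End TriangleMove.

Lemma move_c_homologous (R : realType) (al be : vstring R) :
  move_c al be -> homologous (string_matrix al) (string_matrix be).
Proof.
move=> [a [a' [b [b' [c [c' [[in1 in2 in3] [ab bc ca] sides_free beE]]]]]]].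
exact: triangle_move_homologous in1 in2 in3 ab bc ca sides_free beE.
Qed.


Theorem lemma7p1p1 (R : realType) (al be : vstring R) :
  homotopic al be -> homologous (string_matrix al) (string_matrix be).
Proof.
elim=> {al be} [al be [|||]|al|al be _|al be ga _ IH1 _ IH2].
- exact: string_homeo_homologous.
- exact: move_a_homologous.
- exact: move_b_homologous.
- exact: move_c_homologous.
- exact: rst_refl.
- exact: rst_sym.
- exact: rst_trans IH1 IH2.
Qed.
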